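(* Let $f>0$, $\kappa>0$, $r\ge 0$, and let $\|\cdot\|$ be the $L_1$ norm $\|(y_1,y_2)\|=|y_1|+|y_2|$ on $\mathbb{R}^2$. Put $\alpha^*(r)=\arctan\bigl(2r+\sqrt{2r+4r^2}\bigr)$ and $$\bar g(r)=\frac{3\,\bigl(2\cos\alpha^*(r)\bigr)^{1/2}\bigl(2\sin\alpha^*(r)+\cos\alpha^*(r)\bigr)^{3/2}}{3\sin(2\alpha^*(r))-2\cos(2\alpha^*(r))+4}.$$ Then the optimal value of the transshipment facility layout problem (defined in the context) is $$z=3\sqrt[3]{\frac{\kappa^2 f^3}{4\,\bar g^2(r)}},$$ and the optimal shape of the service regions is an elongated hexagon: $z$ is attained by a design all of whose service regions are translates of one elongated hexagon with parameter $\alpha=\alpha^*(r)$.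
   Context: Problem. A design consists of: (i) a locally finite infinite set $X\subset\mathbb{R}^2$ of facility locations; (ii) service regions $\mathcal{A}(p)$, $p\in X$, which are measurable sets of finite positive area, cover $\mathbb{R}^2$, overlap pairwise only in null sets, and satisfy $\|x-p\|\le\|x-q\|$ for all $x\in\mathcal{A}(p)$ and $q\in X$ (Voronoi diagram, ties broken arbitrarily); (iii) for each $N\ge 1$ a closed inbound truck tour $x_1,x_2,\dots,x_N,x_1$ through $N$ distinct facilities of $X$ (the choice may depend on $N$; indices are taken modulo $N$), such that, with $\mathcal{A}_i=\mathcal{A}(x_i)$ and $A_i=|\mathcal{A}_i|$ (area), the sets $U_N=\bigcup_{i=1}^N\mathcal{A}_i$ exhaust the plane: there are $\rho_N\to\infty$ such that, for all large $N$, the Euclidean disc $B(0,\rho_N)$ is contained in $U_N$ up to a null set, and $|U_N\setminus B(0,\rho_N)|/|U_N|\to0$. The truck's travel distance attributed to facility $i$ is $l_i=\frac12(\|x_i-x_{i-1}\|+\|x_i-x_{i+1}\|)$. The cost of the design is $$\liminf_{N\to\infty}\ \left[\frac{f}{\sum_{i=1}^N A_i}\sum_{i=1}^N\Bigl(1+\kappa\int_{\mathcal{A}_i}\|x-x_i\|\,dx\Bigr)+\frac{\kappa r f}{N}\sum_{i=1}^N l_i\right],$$ and $z$ is the infimum of the cost over all designs. An elongated hexagon with parameters $R>0$, $\alpha\in[0,\pi/2)$ and facility at the origin is the set $\{(y_1,y_2): |y_1|\le R\cos\alpha,\ |y_1|+|y_2|\le R(\cos\alpha+\sin\alpha)\}$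 (or its image under swapping the two coordinates); it is the intersection of a square with diagonals parallel to the axes and a strip bounded by two lines perpendicular to the truck's direction of travel. For $\alpha=0$ it degenerates to a square. *)

(* Defs.v *)
From HB Require Import structures.
From mathcomp Require Import all_boot all_order all_algebra.
From mathcomp Require Import all_classical all_reals all_analysis.

Set Implicit Arguments.
Unset Strict Implicit.
Unset Printing Implicit Defensive.
Import Order.TTheory GRing.Theory Num.Theory.
Import numFieldNormedType.Exports.

Local Open Scope classical_set_scope.
Local Open Scope ring_scope.

(* [area] is the complete two-dimensional Lebesgue measure, and
   [lebesgue_measurable] its sigma-algebra, which is larger than the Borel one. *)
Section area.
Context (R : realType).

Local Notation borel_area := (@lebesgue_measure R \x @lebesgue_measure R)%E.

Definition area := @completed_measure_extension _ _ R borel_area.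
HB.instance Definition _ := Measure.on area.

Definition lebesgue_measurable : set (set (R * R)) :=
  (borel_area^*)%mu.-cara.-measurable.

End area.

Section design.
Context (R : realType).
Implicit Types (nrm : R * R -> R) (f kappa r : R).

Definition l1norm (y : R * R) : R := `|y.1| + `|y.2|.

Definition disc (rho : R) : set (R * R) :=
  [set y | Num.sqrt (y.1 ^+ 2 + y.2 ^+ 2) <= rho].

(* [region p] is only meaningful for [p] in [facilities]. *)
Record design_data := DesignData {
  facilities : set (R * R);
  region : R * R -> set (R * R);
  tour : forall N : nat, 'I_N -> R * R }.

Definition tour_regions (D : design_data) (N : nat) : set (R * R) :=
  \bigcup_(i in [set: 'I_N]) region D (tour D i).

Record is_design nrm (D : design_data) : Prop := {
  facilities_infinite : infinite_set (facilities D);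
  facilities_locally_finite :
    forall rho : R, finite_set (facilities D `&` disc rho);
  region_measurable : forall p, facilities D p ->
    lebesgue_measurable (region D p);
  region_area : forall p, facilities D p ->
    (0 < area (region D p))%E /\ (area (region D p) < +oo)%E;
  region_cover : \bigcup_(p in facilities D) region D p = setT;
  region_overlap : forall p q, facilities D p -> facilities D q -> p <> q ->
    area (region D p `&` region D q) = 0%E;
  region_nearest : forall p q x, facilities D p -> facilities D q ->
    region D p x -> nrm (x - p) <= nrm (x - q);
  tour_facility : forall N (i : 'I_N), facilities D (tour D i);
  tour_injective : forall N, injective (@tour D N);
  tour_exhausts : exists rho : nat -> R,
    [/\ rho @ \oo --> +oo,
        \forall N \near \oo, area (disc (rho N) `\` tour_regions D N) = 0%E
      & (area (tour_regions D N `\` disc (rho N)) / area (tour_regions D N))%E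
          @[N --> \oo] --> 0%E] }.

Definition travel nrm (D : design_data) (N : nat) (i : 'I_N) : R :=
  2^-1 * (nrm (tour D i - tour D (ord_pred i)) +
          nrm (tour D i - tour D (ordS i))).

Definition partial_cost nrm f kappa r (D : design_data) (N : nat) : \bar R :=
  (f%:E / (\sum_(i < N) area (region D (tour D i))) *
     (\sum_(i < N) (1 + kappa%:E *
        \int[@area R]_(x in region D (tour D i)) (nrm (x - tour D i))%:E)) +
   (kappa * r * f / N%:R * (\sum_(i < N) travel nrm D i)%R)%:E)%E.

Definition cost nrm f kappa r (D : design_data) : \bar R :=
  limn_einf (partial_cost nrm f kappa r D).

Definition optimal_value nrm f kappa r : \bar R :=
  ereal_inf [set cost nrm f kappa r D | D in is_design nrm].

Definition hexagon (s alpha : R) : set (R * R) :=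
  [set y | `|y.1| <= s * cos alpha /\
           `|y.1| + `|y.2| <= s * (cos alpha + sin alpha)].

Definition elongated_hexagon (alpha : R) (H : set (R * R)) : Prop :=
  0 <= alpha < pi / 2 /\
  exists2 s : R, 0 < s &
    H = hexagon s alpha \/ H = [set (y.2, y.1) | y in hexagon s alpha].

Definition alpha_star r : R := atan (2 * r + Num.sqrt (2 * r + 4 * r ^+ 2)).

Definition gbar r : R :=
  let a := alpha_star r in
  3 * (2 * cos a) `^ (1 / 2) * (2 * sin a + cos a) `^ (3 / 2) /
  (3 * sin (2 * a) - 2 * cos (2 * a) + 4).

End design.

(* Main.v *)
Require Import Defs.
From HB Require Import structures.
From mathcomp Require Import all_boot all_order all_algebra.
From mathcomp Require Import all_classical all_reals all_analysis measurable_realfun.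
From mathcomp Require Import ring lra zify.
Set Implicit Arguments.
Unset Strict Implicit.
Unset Printing Implicit Defensive.
Import Order.TTheory GRing.Theory Num.Theory.
Import numFieldNormedType.Exports.
Local Open Scope classical_set_scope.
Local Open Scope ring_scope.

(** The theorem has two halves: a lower bound on the cost of every design, and
    one design, a lattice of hexagons swept by tours, that meets the bound.

    Lower bound. Let [p_1, ..., p_N] be a tour through regions [A_1, ..., A_N],
    and put at each [p_i] the cone [x |-> max (l - |x - p_i|) 0], of integral
    [2/3 l^3]. As [|x - p_i|] plus the cone is at least [l], the transport cost
    of [A_i] is at least [l |A_i|] minus the integral of the cone over [A_i]
    ([le_area_region]). The regions do not overlap, so the integrals of the
    cones over their regions add up to at most the integral of the upper
    envelope of all cones. Along the tour, each new cone raises the envelope by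
    at most its excess over the preceding one, and two consecutive cones have in
    common at least the cone of height [l - h_i] at the midpoint of [p_(i-1)]
    and [p_i], where [2 h_i = |p_i - p_(i-1)|]. So the integrals add up to at
    most [sum_i 2/3 (l^3 - (l - h_i)_+^3)] plus a boundary term [2/3 l^3]
    ([sum_integral_cone_le]). For elongated hexagons this is sharp up to the
    boundary term: the previous and the next facility cut two opposite corners
    off the ball of radius [l].

    The cube is convex, so a tangent line replaces the [h_i] by the mean tour
    leg. With [y^2] the mean area of the regions, the choice [l = y (h + u)],
    [u^2 = r] makes the tour length cancel, and the cost is at least
    [f (1/y^2 + kappa G y)] up to a factor [1 - O(1/N)], where [G] depends on [h]
    and [u] only ([cost_algebra]). The best [h] is the one for which the hexagon
    [|x_1| <= h, |x| <= h + u] has area 1; then [G] is the inverse of [gbar r]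
    ([gbarE]), and minimising over [y] gives the stated value ([am_gm_cost]).

    Attainment. For [h > 0] and [u >= 0] the translates of that hexagon by a
    lattice tile the plane, and they are Voronoi cells because two sites are
    either at distance at least [2 (h + u)], or in a common row at horizontal
    distance at least [2 h] ([site_separated]). A tour sweeps the rows of sites
    in a disc of radius [m] in alternating directions. Chords of a disc in
    consecutive rows differ in length by [O(sqrt m)], so that the [O(m)] changes
    of row cost [O(m sqrt m)], little compared with the order [m^2] of the
    number of sites ([path_block_le]). When [N] lies between the numbers of
    sites for [m] and [m + 1], the missing sites, again [O(m sqrt m)] many
    because they fit in an annulus ([area_annulus_le]), are taken from one
    further row. The mean tour leg thus tends to [2 h], which gives the cost of
    the design ([cost_hexagonal_le]); scaling the hexagon of parameter
    [alpha_star r] to the minimising area makes it equal to the lower bound. *)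

(** The domain of [area], whose measurable sets are those of [lebesgue_measurable]. *)
Local Notation plane R := (caratheodory_type ((@lebesgue_measure R \x @lebesgue_measure R)%E^*)%mu).

(** * Integration against the completed area *)

Section plane.
Context (R : realType).
Local Notation borel_area := (@lebesgue_measure R \x @lebesgue_measure R)%E.
Local Notation mR := (measurableTypeR R).

Lemma borel_lebesgue (A : set (mR * mR)) :
  measurable A -> lebesgue_measurable (A : set (R * R)).
Proof. by move=> mA; apply: caratheodory_measurable_mu_ext. Qed.

Lemma areaE (A : set (mR * mR)) :
  measurable A -> area (A : set (R * R)) = borel_area A.
Proof. by move=> mA; rewrite /area /completed_measure_extension/= measurable_mu_extE. Qed.

Lemma measurable_fun_area d (T : measurableType d) (f : mR * mR -> T) :
  measurable_fun setT f -> measurable_fun setT (f : (plane R) -> T).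
Proof.
move=> mf _ B mB; apply: borel_lebesgue; exact: mf.
Qed.

(** The identity pushes the completed measure forward to the product measure;
    this makes Fubini available for Borel integrands. *)
Lemma ge0_integral_area (D : set (mR * mR)) (f : mR * mR -> \bar R) :
  measurable D -> measurable_fun setT f -> (forall x, 0 <= f x)%E ->
  (\int[@area R]_(x in D) f x = \int[borel_area]_(x in D) f x)%E.
Proof.
move=> mD mf f0.
have mid : measurable_fun setT (id : (plane R) -> mR * mR).
  by apply: measurable_fun_area; exact: measurable_id.
have := @ge0_integral_pushforward _ _ (plane R) (mR * mR)%type R id mid (@area R) D f mD.
move=> /(_ (measurable_funS measurableT (@subsetT _ _) mf)).
have f0' : {in D, forall y, 0 <= f y}%E by move=> y _.
move=> /(_ f0') <-.
apply: eq_measure_integral => A mA _.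
exact: (areaE mA).
Qed.
End plane.

(** * Integrals over elongated hexagons *)

Section segment.
Context (R : realType).
Local Notation mu := (@lebesgue_measure R).

Lemma continuous_quadratic (p q s c : R) :
  continuous (fun x : R => p + q * (x - c) + s * (x - c) ^+ 2).
Proof.
move=> x; apply: differentiable_continuous; apply/derivable1_diffP; exact: ex_derive.
Qed.

Lemma is_derive_cubic (p q s c x : R) :
  is_derive x (1 : R)
    (fun x : R => p * (x - c) + q * (x - c) ^+ 2 / 2 + s * (x - c) ^+ 3 / 3)
    (p + q * (x - c) + s * (x - c) ^+ 2).
Proof.
apply: is_derive_eq.
by rewrite /GRing.scale/=; field.
Qed.

Lemma integral_quadratic (p q s c a b : R) : a <= b ->
  (\int[mu]_(x in `[a, b]) (p + q * (x - c) + s * (x - c) ^+ 2)%:E =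
   (p * (b - c) + q * (b - c) ^+ 2 / 2 + s * (b - c) ^+ 3 / 3 -
   (p * (a - c) + q * (a - c) ^+ 2 / 2 + s * (a - c) ^+ 3 / 3))%:E)%E.
Proof.
rewrite le_eqVlt => /predU1P[<-|ab].
  by rewrite set_itv1 integral_set1 subrr.
have cF : continuous (fun x : R => p * (x - c) + q * (x - c) ^+ 2 / 2 + s * (x - c) ^+ 3 / 3).
  by move=> x; apply: differentiable_continuous; apply/derivable1_diffP; exact: ex_derive.
rewrite (@continuous_FTC2 _ _ (fun x : R => p * (x - c) + q * (x - c) ^+ 2 / 2 + s * (x - c) ^+ 3 / 3))//.
- exact/continuous_subspaceT/continuous_quadratic.
- split.
  + by move=> x _; have [] := is_derive_cubic p q s c x.
  + exact/cvg_at_right_filter/cF.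
  + exact/cvg_at_left_filter/cF.
- move=> x _; rewrite derive1E; by have /@derive_val := is_derive_cubic p q s c x.
Qed.


Lemma integral_quadratic_norm (p q s c a : R) : 0 <= a ->
  (forall t, 0 <= t <= a -> 0 <= p + q * t + s * t ^+ 2) ->
  (\int[mu]_(x in `[(c - a)%R, (c + a)%R]) (p + q * `|x - c| + s * `|x - c| ^+ 2)%:E =
   (2 * (p * a + q * a ^+ 2 / 2 + s * a ^+ 3 / 3))%:E)%E.
Proof.
move=> a0 f0.
have mf : measurable_fun setT (fun x : R => (p + q * `|x - c| + s * `|x - c| ^+ 2)%:E).
  apply/measurable_EFinP; apply: continuous_measurable_fun => x.
  have cn : continuous (fun x : R => `|x - c|).
    move=> y; apply: (@continuous_comp _ _ _ (fun x => x - c) Num.norm).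
      by apply: cvgB; [exact: cvg_id|exact: cvg_cst].
    exact: norm_continuous.
  apply: (@continuous_comp _ _ _ (fun x => `|x - c|) (fun t => p + q * t + s * t ^+ 2)).
    exact: cn.
  have := @continuous_quadratic p q s 0 `|x - c|.
  by under eq_fun do rewrite subr0.
rewrite (@itv_bndbnd_setU _ _ (BLeft (c - a)) (BLeft c) (BRight (c + a))); last 2 first.
- by rewrite bnd_simp; lra.
- by rewrite bnd_simp; lra.
rewrite ge0_integral_setU//=; last 3 first.
- exact: measurable_funS mf.
- move=> x; rewrite /= !in_itv/= => xac; rewrite lee_fin f0// normr_ge0/= ler_norml.
  by case: xac => /andP[h1 h2]; apply/andP; split; lra.
- apply/disj_set2P; rewrite -subset0 => x []; rewrite /= !in_itv/= => /andP[_ h1] /andP[h2 _].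
  by move: h1; rewrite ltNge h2.
rewrite integral_itv_bndo_bndc; last exact: measurable_funS mf.
rewrite (@eq_integral _ _ _ mu `[c - a, c] (fun x => (p + (- q) * (x - c) + s * (x - c) ^+ 2)%:E)); last first.
  move=> x; rewrite inE/= in_itv/= => /andP[_ xc].
  by rewrite ler0_norm ?subr_le0//; congr (_%:E); ring.
rewrite (@eq_integral _ _ _ mu `[c, c + a] (fun x => (p + q * (x - c) + s * (x - c) ^+ 2)%:E)); last first.
  move=> x; rewrite inE/= in_itv/= => /andP[xc _].
  by rewrite ger0_norm ?subr_ge0.
rewrite !integral_quadratic; [|lra|lra].
by rewrite -EFinD; congr (_%:E); field.
Qed.

End segment.

Section cell.
Context (R : realType).
Local Notation mu := (@lebesgue_measure R).
Local Notation mR := (measurableTypeR R).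

Definition cell (c : R * R) (a l : R) : set (R * R) :=
  [set x | `|x.1 - c.1| <= a /\ l1norm (x - c) <= l].

Lemma measurable_dist1 (c : R * R) : measurable_fun setT (fun x : mR * mR => `|x.1 - c.1| : R).
Proof.
apply: measurableT_comp => //; apply: measurable_funB => //; exact: measurable_fst.
Qed.

Lemma measurable_l1norm (c : R * R) :
  measurable_fun setT (fun x : mR * mR => l1norm (x - c) : R).
Proof.
apply: measurable_funD; first exact: measurable_dist1.
apply: measurableT_comp => //; apply: measurable_funB => //; exact: measurable_snd.
Qed.

Lemma measurable_cell (c : R * R) (a l : R) : measurable (cell c a l : set (mR * mR)).
Proof.
rewrite (_ : cell c a l = [set x | `|x.1 - c.1| <= a] `&` [set x | l1norm (x - c) <= l])//.
apply: measurableI; rewrite -[X in measurable X]setTI.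
- have := @measurable_dist1 c measurableT `]-oo, a]%classic (measurable_itv _).
  by rewrite set_itvE.
- have := @measurable_l1norm c measurableT `]-oo, l]%classic (measurable_itv _).
  by rewrite set_itvE.
Qed.

(** Affine functions of the distance cover both the area and the transport cost,
    and their integral over a vertical section is a quadratic polynomial in
    [`|x.1 - c.1|], of the kind treated in [integral_quadratic_norm]. *)
Lemma integral_cell (c : R * R) (a l p q : R) : 0 <= a <= l -> 0 <= p -> 0 <= q ->
  (\int[@area R]_(x in cell c a l) (p + q * l1norm (x - c))%:E =
   (2 * ((2 * p * l + q * l ^+ 2) * a - p * a ^+ 2 - q * a ^+ 3 / 3))%:E)%E.
Proof.
move=> /andP[a0 al] p0 q0.
have l0 x : 0 <= l1norm (x - c) by rewrite addr_ge0.
have mf : measurable_fun [set: mR * mR] (fun x => (p + q * l1norm (x - c))%:E).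
  apply/measurable_EFinP; apply: measurable_funD => //; apply: measurable_funM => //.
  exact: measurable_l1norm.
rewrite ge0_integral_area//; last 2 first.
- exact: measurable_cell.
- by move=> x; rewrite lee_fin addr_ge0// mulr_ge0.
rewrite integral_mkcond fubini_tonelli1; last 2 first.
- apply: (iffLR (measurable_restrictT _ _)); last exact: measurable_funS mf.
  exact: measurable_cell.
- by move=> x; rewrite patchE; case: ifP => // _; rewrite lee_fin addr_ge0// mulr_ge0.
transitivity (\int[mu]_(x in `[(c.1 - a)%R, (c.1 + a)%R])
    ((2 * p * l + q * l ^+ 2) + (- 2 * p) * `|x - c.1| + (- q) * `|x - c.1| ^+ 2)%:E)%E; last first.
  rewrite integral_quadratic_norm//.
    by congr (_%:E); field.
  move=> t /andP[t0 ta].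
  have : 0 <= 2 * p * (l - t) + q * ((l - t) * (l + t)).
    by rewrite addr_ge0 ?mulr_ge0//; lra.
  by lra.
rewrite [RHS]integral_mkcond; apply: eq_integral => x _; rewrite /fubini_F patchE.
case: ifPn => [|/negP]; rewrite inE/= in_itv/= => xa.
- have xa' : `|x - c.1| <= a by rewrite ler_norml; case/andP: xa => *; apply/andP; split; lra.
  set t := `|x - c.1| in xa' *.
  have t0 : 0 <= t by rewrite normr_ge0.
  transitivity (\int[mu]_(y in `[(c.2 - (l - t))%R, (c.2 + (l - t))%R])
    ((p + q * t) + q * `|y - c.2| + 0 * `|y - c.2| ^+ 2)%:E)%E; last first.
    rewrite integral_quadratic_norm//.
    + by congr (_%:E); field.
    + lra.
    + by move=> s /andP[s0 sa]; rewrite mul0r addr0 !addr_ge0// mulr_ge0.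
  rewrite [RHS]integral_mkcond; apply: eq_integral => y _; rewrite !patchE.
  have -> : ((x, y) \in cell c a l) = (y \in `[(c.2 - (l - t)), (c.2 + (l - t))]%classic).
    apply/idP/idP; rewrite !inE/= in_itv/= -?/t.
      move=> [_]; rewrite /l1norm/= -/t => tl.
      have : `|y - c.2| <= l - t by lra.
      by rewrite ler_norml => /andP[? ?]; apply/andP; split; lra.
    move=> /andP[? ?]; split; rewrite // /l1norm/= -/t.
    have : `|y - c.2| <= l - t by rewrite ler_norml; apply/andP; split; lra.
    lra.
  by case: ifP => // _; congr (_%:E); rewrite /l1norm/= -/t; ring.
- apply: integral0_eq => y _; rewrite patchE ifF//; apply/negbTE.
  apply/negP; rewrite inE => -[/= xa' _]; apply: xa.
  by move: xa'; rewrite ler_norml => /andP[? ?]; apply/andP; split; lra.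
Qed.

Lemma area_cell (c : R * R) (a l : R) : 0 <= a <= l ->
  area (cell c a l) = (4 * l * a - 2 * a ^+ 2)%:E.
Proof.
move=> al; have := @integral_cell c a l 1 0 al ler01 (lexx _).
rewrite (eq_integral (cst 1%E)); last by move=> x _; rewrite mul0r addr0.
rewrite integral_cst; last exact: borel_lebesgue (measurable_cell _ _ _).
by rewrite mul1e => ->; congr (_%:E); ring.
Qed.

Lemma integral_norm_cell (c : R * R) (a l : R) : 0 <= a <= l ->
  (\int[@area R]_(x in cell c a l) (l1norm (x - c))%:E =
   (2 * (l ^+ 2 * a - a ^+ 3 / 3))%:E)%E.
Proof.
move=> al; have := @integral_cell c a l 0 1 al (lexx _) ler01.
under eq_integral do rewrite add0r mul1r.
by move=> ->; congr (_%:E); ring.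
Qed.

End cell.

(** * Cones along a tour *)

Section packing.
Context d (T : measurableType d) (R : realType).
Variable mu : {measure set T -> \bar R}.
Local Open Scope ereal_scope.

(** Outside a null set each point lies in at most one [A i], so at most one
    summand is nonzero there. *)
Lemma sum_integral_le N (A : 'I_N -> set T) (g : 'I_N -> T -> \bar R) (G : T -> \bar R) :
  (forall i, measurable (A i)) ->
  (forall i j, i != j -> mu (A i `&` A j) = 0) ->
  (forall i, measurable_fun setT (g i)) -> (forall i x, 0 <= g i x) ->
  measurable_fun setT G -> (forall x, 0 <= G x) ->
  (forall i x, A i x -> g i x <= G x) ->
  \sum_(i < N) \int[mu]_(x in A i) g i x <= \int[mu]_x G x.
Proof.
move=> mA A0 mg g0 mG G0 gG.
have mgA i : measurable_fun setT (g i \_ (A i)).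
  apply: (iffLR (measurable_restrictT _ _)) => //; exact: measurable_funS (mg i).
have gA0 i x : 0 <= (g i \_ (A i)) x by rewrite patchE; case: ifP.
under eq_bigr do rewrite integral_mkcond.
rewrite -ge0_integral_sum//.
apply: ae_ge0_le_integral => //.
- by move=> x _; apply: sume_ge0.
- exact: emeasurable_sum.
have : \forall x \ae mu, forall ij : 'I_N * 'I_N, ij.1 != ij.2 -> ~ (A ij.1 `&` A ij.2) x.
  apply: filter_forall => -[i j]/=; have [->|ij] := eqVneq i j; first exact: aeW.
  exists (A i `&` A j); split; [exact: measurableI|exact: A0|].
  by move=> x /= /not_implyP[_ /contrapT].
apply: filterS => x Hx _.
have [[i Aix]|nA] := pselect (exists i, A i x).
  rewrite (bigD1 i)//= big1 ?adde0 => [|j ji].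
    by rewrite patchE mem_set//; exact: gG.
  rewrite patchE memNset// => Ajx; exact: (Hx (j, i) ji).
rewrite big1 => [|i _]; first exact: G0.
by rewrite patchE memNset// => Aix; apply: nA; exists i.
Qed.

End packing.

Section cone.
Context (R : realType).
Local Notation mR := (measurableTypeR R).

Definition cone (l : R) (c x : R * R) : R := Num.max (l - l1norm (x - c)) 0.

Lemma cone_ge0 l c x : 0 <= cone l c x.
Proof. by rewrite /cone le_max lexx orbT. Qed.

Lemma l1norm_ge0 (x : R * R) : 0 <= l1norm x.
Proof. by rewrite addr_ge0. Qed.

Lemma l1normB (x y : R * R) : l1norm (x - y) = l1norm (y - x).
Proof. by rewrite /l1norm/= distrC [X in _ + X]distrC. Qed.

Lemma measurable_cone (l : R) (c : R * R) :
  measurable_fun setT (fun x : mR * mR => (cone l c x)%:E).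
Proof.
apply/measurable_EFinP; apply: measurable_maxr => //.
by apply: measurable_funB => //; exact: measurable_l1norm.
Qed.

(** On the ball of radius [l] the cone and the distance to [c] add up to [l],
    so the integral is a difference of two integrals over a cell. *)
Lemma integral_cone (l : R) (c : R * R) :
  (\int[@area R]_x (cone l c x)%:E = (2 / 3 * Num.max l 0 ^+ 3)%:E)%E.
Proof.
have [l0|/ltW l0] := leP l 0.
  rewrite integral0_eq ?expr0n ?mulr0// => x _.
  rewrite /cone; congr (_%:E); apply/max_idPr.
  by rewrite subr_le0 (le_trans l0)// l1norm_ge0.
have mC : measurable (cell c l l : set (plane R)) by exact: borel_lebesgue (measurable_cell _ _ _).
have ll : 0 <= l <= l by rewrite l0 lexx.
have Ecell : (\int[@area R]_x (cone l c x)%:E = \int[@area R]_(x in cell c l l) (cone l c x)%:E)%E.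
  rewrite [RHS]integral_mkcond; apply: eq_integral => x _; rewrite patchE; case: ifPn => //.
  move=> /negP; rewrite inE => xl; rewrite /cone; congr (_%:E); apply/max_idPr.
  rewrite subr_le0 leNgt; apply/negP => /ltW xl'; apply: xl; split => //.
  by rewrite (le_trans _ xl')// lerDl.
have := @integral_cst _ _ _ (@area R) _ mC l%:E.
have -> : (\int[@area R]_(x in cell c l l) cst l%:E x =
    \int[@area R]_(x in cell c l l) ((cone l c x)%:E + (l1norm (x - c))%:E))%E.
  apply: eq_integral => x /[!inE] -[_ xl]; rewrite -EFinD; congr (_%:E).
  by rewrite /cone max_l ?subr_ge0// subrK.
have c0 (x : (plane R)) : cell c l l x -> (0 <= (cone l c x)%:E)%E by rewrite lee_fin cone_ge0.
have n0 (x : (plane R)) : cell c l l x -> (0 <= (l1norm (x - c))%:E)%E by rewrite lee_fin l1norm_ge0.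
have mcC : measurable_fun (cell c l l : set (plane R)) (fun x : (plane R) => (cone l c x)%:E).
  exact: measurable_funS (measurable_fun_area (measurable_cone l c)).
have mnC : measurable_fun (cell c l l : set (plane R)) (fun x : (plane R) => (l1norm (x - c))%:E).
  apply: measurable_funS (measurable_fun_area _) => //.
  by apply/measurable_EFinP; exact: measurable_l1norm.
rewrite (@ge0_integralD _ (plane R) R (@area R) _ mC _ _ c0 mcC n0 mnC).
rewrite -Ecell integral_norm_cell// => H.
move: H => /(congr1 (fun y => y - (2 * (l ^+ 2 * l - l ^+ 3 / 3))%:E)%E); rewrite addeK// => ->.
rewrite [X in (_ * X)%E](_ : _ = (4 * l * l - 2 * l ^+ 2)%:E); last exact: area_cell.
by rewrite -EFinM -EFinB; congr (_%:E); field.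
Qed.

Lemma l1norm_mid (a b x : R * R) :
  l1norm (x - a) <= l1norm (x - 2^-1 *: (a + b)) + 2^-1 * l1norm (a - b).
Proof.
have half (s t u : R) : `|s - t| <= `|s - 2^-1 * (t + u)| + 2^-1 * `|t - u|.
  rewrite -[X in _ <= _ + X * _](@ger0_norm _ 2^-1)// -normrM.
  by apply: le_trans (ler_normB _ _); rewrite (_ : s - t = s - 2^-1 * (t + u) - 2^-1 * (t - u))//; field.
have := half x.1 a.1 b.1; have := half x.2 a.2 b.2.
rewrite /l1norm/= /GRing.scale/=; lra.
Qed.

(** The ball of radius [l - |a - b| / 2] at the midpoint lies in the balls of
    radius [l] at [a] and at [b]. Used for both, this bounds from below what the
    two cones have in common. *)
Lemma cone_mid (l : R) (a b x : R * R) :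
  cone (l - 2^-1 * l1norm (a - b)) (2^-1 *: (a + b)) x <= cone l a x.
Proof.
rewrite /cone; set u := _ - _ - _; set v := l - _.
have uv : u <= v by have := l1norm_mid a b x; rewrite /u /v; lra.
by rewrite ge_max !le_max lexx uv !orbT.
Qed.

Fixpoint running_max (a : nat -> R) n : R :=
  if n is m.+1 then Num.max (running_max a m) (a n) else a 0.

Lemma le_running_max (a : nat -> R) i n : (i <= n)%N -> a i <= running_max a n.
Proof.
elim: n => [|n IH]; first by rewrite leqn0 => /eqP ->.
rewrite leq_eqVlt => /predU1P[->|]; first by rewrite /= le_max lexx orbT.
by rewrite ltnS => /IH h; rewrite /= le_max h.
Qed.

(** Here [b i.+1] stands for a lower bound of the common part of two consecutive
    terms: a new term raises the maximum by at most its excess over the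
    preceding one. *)
Lemma running_max_sum_le (a b : nat -> R) n :
  (forall i, b i.+1 <= a i) -> (forall i, b i.+1 <= a i.+1) ->
  running_max a n + \sum_(i < n) b i.+1 <= \sum_(i < n.+1) a i.
Proof.
move=> ba ba'; elim: n => [|n IH]; first by rewrite big_ord0 addr0 big_ord1.
rewrite [\sum_(i < n.+2) a i]big_ord_recr/= [\sum_(i < n.+1) b i.+1]big_ord_recr/=.
have := @le_running_max a n n (leqnn n).
have := ba n; have := ba' n; case: (leP (running_max a n) (a n.+1)); lra.
Qed.

End cone.

Section tour_cones.
Context (R : realType).

Let mcone (l : R) c : measurable_fun setT (fun x : (plane R) => (cone l c x)%:E).
Proof. exact: measurable_fun_area (measurable_cone l c). Qed.

Let mconeR (l : R) c : measurable_fun setT (fun x : (plane R) => cone l c x).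
Proof. by apply/measurable_EFinP; exact: mcone. Qed.

(** The sum runs over all legs of the closed tour, including the leg that
    returns to the start. The first cone has no predecessor, and crediting it
    with the closing leg costs at most one further cone: hence [n.+2]. *)
Lemma sum_integral_cone_le n (A : 'I_n.+1 -> set (R * R)) (p : 'I_n.+1 -> R * R) (l : R) :
  0 <= l -> (forall i, lebesgue_measurable (A i)) ->
  (forall i j, i != j -> area (A i `&` A j) = 0%E) ->
  (\sum_(i < n.+1) \int[@area R]_(x in A i) (cone l (p i) x)%:E +
   (\sum_(i < n.+1) 2 / 3 * Num.max (l - 2^-1 * l1norm (p i - p (ord_pred i))) 0 ^+ 3)%:E <=
   (n.+2%:R * (2 / 3 * l ^+ 3))%:E)%E.
Proof.
move=> l0 mA A0.
pose q k := p (inord k).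
pose a x k := cone l (q k) x.
pose b x k := cone (l - 2^-1 * l1norm (q k - q k.-1)) (2^-1 *: (q k + q k.-1)) x.
have b0 x k : 0 <= b x k by exact: cone_ge0.
have M0 x : 0 <= running_max (a x) n.
  by apply: le_trans (le_running_max _ (leq0n n)); exact: cone_ge0.
have mM : measurable_fun setT (fun x : (plane R) => (running_max (a x) n)%:E).
  apply/measurable_EFinP; elim: (n) => [|k IH]; first exact: mconeR.
  exact: (measurable_maxr IH (mconeR l (q k.+1))).
have H1 : (\sum_(i < n.+1) \int[@area R]_(x in A i) (cone l (p i) x)%:E <=
    \int[@area R]_x (running_max (a x) n)%:E)%E.
  apply: (@sum_integral_le _ (plane R) _ (@area R) n.+1 A (fun i x => (cone l (p i) x)%:E)) => //.
  - by move=> i x; rewrite lee_fin cone_ge0.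
  - move=> i x _; rewrite lee_fin -[p i](_ : q i = _); last by rewrite /q inord_val.
    by apply: (@le_running_max _ (a x)); rewrite -ltnS.
have H2 : (\int[@area R]_x (running_max (a x) n)%:E +
    \sum_(i < n) \int[@area R]_x (b x i.+1)%:E <=
    \sum_(i < n.+1) \int[@area R]_x (a x i)%:E)%E.
  have a0 (k : 'I_n.+1) x : (0 <= (a x k)%:E)%E by rewrite lee_fin cone_ge0.
  have b0E (k : 'I_n) x : (0 <= (b x k.+1)%:E)%E by rewrite lee_fin b0.
  have ma (k : 'I_n.+1) : measurable_fun setT (fun x : (plane R) => (a x k)%:E) by exact: mcone.
  have mb (k : 'I_n) : measurable_fun setT (fun x : (plane R) => (b x k.+1)%:E) by exact: mcone.
  have mB := emeasurable_sum (index_enum 'I_n) mb.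
  have mA' := emeasurable_sum (index_enum 'I_n.+1) ma.
  have B0 x : (0 <= \sum_(i < n) (b x i.+1)%:E)%E by apply: sume_ge0.
  rewrite -(ge0_integral_sum (@area R) measurableT mb (fun k x _ => b0E k x)).
  rewrite -(ge0_integral_sum (@area R) measurableT ma (fun k x _ => a0 k x)).
  have M0E x : (0 <= (running_max (a x) n)%:E)%E by rewrite lee_fin M0.
  rewrite -(ge0_integralD (@area R) measurableT (fun x _ => M0E x) mM (fun x _ => B0 x) mB).
  have MB0 x : (0 <= (running_max (a x) n)%:E + \sum_(i < n) (b x i.+1)%:E)%E.
    exact: adde_ge0.
  apply: (ge0_le_integral (@area R) measurableT (fun x _ => MB0 x) (emeasurable_funD mM mB) mA').
  move=> x _; rewrite !sumEFin -EFinD lee_fin.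
  apply: running_max_sum_le => i; last exact: cone_mid.
  by rewrite /b l1normB [q i.+1 + q _]addrC; exact: cone_mid.
have H3 : (\sum_(i < n.+1) \int[@area R]_x (a x i)%:E = (n.+1%:R * (2 / 3 * l ^+ 3))%:E)%E.
  rewrite (eq_bigr (fun=> (2 / 3 * l ^+ 3)%:E)).
    by rewrite sumEFin sumr_const card_ord -[in LHS](mulr_natl (2 / 3 * l ^+ 3)).
  by move=> i _; rewrite integral_cone max_l.
have H4 : (\sum_(i < n) \int[@area R]_x (b x i.+1)%:E = (\sum_(i < n) 2 / 3 *
    Num.max (l - 2^-1 * l1norm (p (lift ord0 i) - p (ord_pred (lift ord0 i)))) 0 ^+ 3)%:E)%E.
  rewrite -sumEFin; apply: eq_bigr => i _; rewrite integral_cone /q/=.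
  have -> : inord i.+1 = lift ord0 i by apply: val_inj; rewrite /= inordK// ltnS.
  have -> // : inord i = ord_pred (lift ord0 i).
  apply: val_inj; rewrite /= inordK; last by rewrite ltnS ltnW.
  rewrite add0n.
 by rewrite modnDr modn_small// ltnS ltnW.
rewrite [X in (_ + X%:E)%E]big_ord_recl EFinD addeA [X in (X <= _)%E]addeAC.
have -> : n.+2%:R * (2 / 3 * l ^+ 3) = n.+1%:R * (2 / 3 * l ^+ 3) + 2 / 3 * l ^+ 3 :> R.
  by rewrite -[in LHS]natr1 mulrDl mul1r.
rewrite EFinD; apply: leeD.
  by rewrite -H4 -H3; apply: le_trans H2; exact: leeD.
rewrite lee_fin; apply: ler_wpM2l; first lra.
apply: lerXn2r; rewrite ?nnegrE//; first by rewrite le_max lexx orbT.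
by rewrite ge_max l0 andbT lerBlDr lerDl mulr_ge0 ?l1norm_ge0.
Qed.

End tour_cones.

(** * The lower bound *)

Section liminf.
Context (R : realType).

Lemma le_limn_einf (u v : (\bar R)^nat) :
  (\forall n \near \oo, u n <= v n)%E -> (limn_einf u <= limn_einf v)%E.
Proof.
move=> uv; rewrite !limn_einf_lim; apply: lee_lim.
- exact: is_cvg_einfs.
- exact: is_cvg_einfs.
case: uv => n0 _ uv; exists n0 => // n /= n0n.
apply: le_ereal_inf_tmp => _ /= [k nk <-].
apply: le_trans (uv k (leq_trans n0n nk)).
by apply: ereal_inf_lbound; exists k.
Qed.

Lemma cvg_invS (c : R) : (fun n => c / n.+1%:R) @ \oo --> (0 : R).
Proof. by rewrite -(mulr0 c); apply: cvgM; [exact: cvg_cst|exact: cvg_harmonic]. Qed.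

End liminf.

Section pointwise.
Context (R : realType).

Lemma le_area_region (A : set (R * R)) (p : R * R) (l : R) :
  lebesgue_measurable A -> 0 <= l ->
  (l%:E * area A <= \int[@area R]_(x in A) (l1norm (x - p))%:E +
    \int[@area R]_(x in A) (cone l p x)%:E)%E.
Proof.
move=> mA l0.
have mn : measurable_fun setT (fun x : (plane R) => (l1norm (x - p))%:E).
  by apply: measurable_fun_area; apply/measurable_EFinP; exact: measurable_l1norm.
have mc : measurable_fun setT (fun x : (plane R) => (cone l p x)%:E).
  exact: measurable_fun_area (measurable_cone l p).
have n0 (x : (plane R)) : A x -> (0 <= (l1norm (x - p))%:E)%E by rewrite lee_fin l1norm_ge0.
have c0 (x : (plane R)) : A x -> (0 <= (cone l p x)%:E)%E by rewrite lee_fin cone_ge0.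
have mnA : measurable_fun (A : set (plane R)) (fun x : (plane R) => (l1norm (x - p))%:E).
  exact: measurable_funS mn.
have mcA : measurable_fun (A : set (plane R)) (fun x : (plane R) => (cone l p x)%:E).
  exact: measurable_funS mc.
rewrite -(@ge0_integralD _ (plane R) R (@area R) A mA _ _ n0 mnA c0 mcA).
rewrite -[X in (X <= _)%E](@integral_cst _ (plane R) _ (@area R) _ mA l%:E).
have l0' (x : (plane R)) : A x -> (0 <= cst l%:E x)%E by rewrite lee_fin.
apply: (@ge0_le_integral _ (plane R) R (@area R) A mA (cst l%:E)
  (fun x => (l1norm (x - p))%:E + (cone l p x)%:E)%E l0' (measurable_cst _)
  (emeasurable_funD mnA mcA)).
by move=> x _; rewrite -EFinD lee_fin /cone -lerBlDl le_max lexx.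
Qed.

(** Each leg is shared equally by its two ends. *)
Lemma sum_travel nrm (D : design_data R) N : (forall x y, nrm (x - y) = nrm (y - x)) ->
  \sum_(i < N) travel nrm D i = \sum_(i < N) nrm (tour D i - tour D (ord_pred i)).
Proof.
move=> nrmB; rewrite /travel -mulr_sumr big_split/=.
have -> : \sum_(i < N) nrm (tour D i - tour D (ordS i)) =
    \sum_(i < N) nrm (tour D i - tour D (ord_pred i)).
  rewrite [RHS](reindex (@ordS N))/=; last exact/onW_bij/ordS_bij.
  by apply: eq_bigr => i _; rewrite ordSK nrmB.
lra.
Qed.

(** Convexity of the positive part of the cube: its graph lies above the tangent
    at [v]. *)
Lemma pos_cube_tangent (t v : R) : 0 <= v -> v ^+ 3 + 3 * v ^+ 2 * (t - v) <= Num.max t 0 ^+ 3.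
Proof.
move=> v0; case: (leP t 0) => [t0|/ltW t0].
  have : 0 <= v ^+ 2 * (2 * v - 3 * t) by rewrite mulr_ge0 ?sqr_ge0//; lra.
  rewrite expr0n/=; nra.
rewrite -subr_ge0 (_ : _ - _ = (t - v) ^+ 2 * (t + 2 * v)); last by ring.
by rewrite mulr_ge0 ?sqr_ge0//; lra.
Qed.

End pointwise.

Section cost_algebra.
Context (R : realType).
Variables (f kappa r h u w : R).
Hypotheses (f_gt0 : 0 < f) (kappa_gt0 : 0 < kappa).
Hypotheses (h_gt0 : 0 < h) (u_ge0 : 0 <= u) (u_sqr : u ^+ 2 = r).

Let G := h + u - 2 / 3 * h ^+ 3 - 2 * h ^+ 2 * u.
Hypotheses (w_gt0 : 0 < w) (w_cube : 2 * w ^+ 3 = kappa * G).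

(** After multiplication by [y ^+ 2] the difference of the two sides is
    [(w y - 1)^2 (2 w y + 1)]. *)
Lemma am_gm_cost (y : R) : 0 < y -> 3 * w ^+ 2 <= (y ^+ 2)^-1 + kappa * y * G.
Proof.
move=> y0; rewrite (_ : kappa * y * G = 2 * w ^+ 3 * y); last by rewrite w_cube; ring.
have y2 : 0 < y ^+ 2 by rewrite exprn_gt0.
rewrite -(ler_pM2l y2) mulrDr mulfV ?gt_eqF//.
have : 0 <= (w * y - 1) ^+ 2 * (2 * (w * y) + 1).
  by rewrite mulr_ge0 ?sqr_ge0// addr_ge0// mulr_ge0// mulr_ge0 ?ltW.
lra.
Qed.

(** Here [S] is the total area, [B] the bound on the transport cost and [2 * H]
    the length of the tour, for cones of height [y (h + u)] and the tangent at
    [y u]. The coefficient of [H] vanishes because [u ^+ 2 = r]. The boundary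
    term has relative size [O(1/N)] whatever [y] is, so it becomes a factor. *)
Lemma cost_algebra (N y S B H : R) : 1 <= N -> 0 < y -> S = N * y ^+ 2 ->
  y * (h + u) * S - (N + 1) * (2 / 3 * (y * (h + u)) ^+ 3) +
    2 / 3 * (N * (y * u) ^+ 3 + 3 * (y * u) ^+ 2 * (N * (y * h) - H)) <= B ->
  2 / 3 * (h + u) ^+ 3 <= N * G ->
  f * (3 * w ^+ 2) * (1 - 2 / 3 * (h + u) ^+ 3 / G / N) <=
  f / S * (N + kappa * B) + kappa * r * f / N * (2 * H).
Proof.
move=> N1 y0 SE HB GN.
have N0 : 0 < N by lra.
have G0 : 0 < G.
  have k0 : 0 < kappa * G by rewrite -w_cube mulr_gt0// exprn_gt0.
  by rewrite -(pmulr_rgt0 _ kappa_gt0).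
set th := _ / G / N.
have l3 : 0 <= 2 / 3 * (h + u) ^+ 3 by rewrite mulr_ge0 ?exprn_ge0 ?addr_ge0 ?(ltW h_gt0)//; lra.
have th0 : 0 <= th by rewrite /th divr_ge0 ?(ltW N0)// divr_ge0 ?(ltW G0).
have th1 : th <= 1 by rewrite /th ler_pdivrMr// ler_pdivrMr// mul1r.
have H1 : f * ((y ^+ 2)^-1 + kappa * y * (G - 2 / 3 * (h + u) ^+ 3 / N)) <=
    f / S * (N + kappa * B) + kappa * r * f / N * (2 * H).
  apply: (@le_trans _ _ (f / S * (N + kappa * (y * (h + u) * S - (N + 1) * (2 / 3 * (y * (h + u)) ^+ 3) +
    2 / 3 * (N * (y * u) ^+ 3 + 3 * (y * u) ^+ 2 * (N * (y * h) - H)))) + kappa * r * f / N * (2 * H))).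
    rewrite SE -u_sqr /G le_eqVlt; apply/orP; left; apply/eqP; field.
    by rewrite !gt_eqF.
  rewrite lerD2r; apply: ler_wpM2l.
    by rewrite divr_ge0// ?ltW// SE mulr_gt0// exprn_gt0.
  by rewrite lerD2l; apply: ler_wpM2l => //; exact: ltW.
apply: le_trans H1; rewrite -[in X in X <= _]mulrA; apply: ler_wpM2l; first exact: ltW.
have := am_gm_cost y0.
have -> : kappa * y * (G - 2 / 3 * (h + u) ^+ 3 / N) = (1 - th) * (kappa * y * G).
  by rewrite /th; field; rewrite !gt_eqF.
have yy : 0 <= (y ^+ 2)^-1 by rewrite invr_ge0 sqr_ge0.
set a := _^-1 in yy *; set b := kappa * y * G; set c := 3 * w ^+ 2 => cab.
have : 0 <= (1 - th) * (a + b - c) by rewrite mulr_ge0//; lra.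
have : 0 <= th * a by rewrite mulr_ge0.
lra.
Qed.

End cost_algebra.

Section design_lower_bound.
Context (R : realType).
Variables (f kappa r h u w : R).
Hypotheses (f_gt0 : 0 < f) (kappa_gt0 : 0 < kappa).
Hypotheses (h_gt0 : 0 < h) (u_ge0 : 0 <= u) (u_sqr : u ^+ 2 = r).

Let G := h + u - 2 / 3 * h ^+ 3 - 2 * h ^+ 2 * u.
Hypotheses (w_gt0 : 0 < w) (w_cube : 2 * w ^+ 3 = kappa * G).

Lemma partial_cost_ge (D : design_data R) n : is_design (@l1norm R) D ->
  2 / 3 * (h + u) ^+ 3 <= n.+1%:R * G ->
  ((f * (3 * w ^+ 2) * (1 - 2 / 3 * (h + u) ^+ 3 / G / n.+1%:R))%:E <=
   partial_cost (@l1norm R) f kappa r D n.+1)%E.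
Proof.
move=> dD GN.
pose p := @tour R D n.+1; pose A i := region D (p i).
pose Hi i := 2^-1 * l1norm (p i - p (ord_pred i)).
have mA i : lebesgue_measurable (A i) by apply: region_measurable dD _ (tour_facility dD _).
have A0 i j : i != j -> area (A i `&` A j) = 0%E.
  move=> ij; apply: (region_overlap dD); try exact: tour_facility dD _ _.
  by move=> /(tour_injective dD)/eqP; rewrite (negbTE ij).
pose s i := fine (area (A i)).
have sE i : area (A i) = (s i)%:E.
  rewrite /s fineK// fin_numE; have [a0 ay] := region_area dD (tour_facility dD i).
  by rewrite gt_eqF ?lt_eqF//; apply: lt_trans a0; rewrite ltNy0.
have s0 i : 0 < s i by rewrite -lte_fin -sE; have [] := region_area dD (tour_facility dD i).
pose S := \sum_i s i.
have S0 : 0 < S.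
  by rewrite /S big_ord_recl ltr_pwDl// sumr_ge0// => i _; exact: ltW.
have N0 : 0 < n.+1%:R :> R by rewrite ltr0n.
pose y := Num.sqrt (S / n.+1%:R).
have y2 : y ^+ 2 = S / n.+1%:R by rewrite sqr_sqrtr// divr_ge0 ?ltW.
have y0 : 0 < y by rewrite sqrtr_gt0 divr_gt0.
have SE : S = n.+1%:R * y ^+ 2 by rewrite y2 mulrC divfK// gt_eqF.
pose l := y * (h + u).
have l0 : 0 <= l by rewrite mulr_ge0 ?addr_ge0// ltW.
pose I i := (\int[@area R]_(x in A i) (l1norm (x - p i))%:E)%E.
pose B : R := l * S - (n.+1%:R + 1) * (2 / 3 * l ^+ 3) + \sum_(i < n.+1) 2 / 3 * Num.max (l - Hi i) 0 ^+ 3.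
have BI : (B%:E <= \sum_(i < n.+1) I i)%E.
  have C := @sum_integral_cone_le _ _ A p l l0 mA A0.
  have AI : ((l * S)%:E <= \sum_i I i + \sum_i \int[@area R]_(x in A i) (cone l (p i) x)%:E)%E.
    rewrite -big_split/= EFinM /S -sumEFin ge0_sume_distrr; last first.
      by move=> i _; rewrite lee_fin ltW.
    by apply: lee_sum => i _; rewrite -sE; exact: le_area_region.
  set J := (\sum_i \int[@area R]_(x in A i) _)%E in C AI.
  have J0 : (0 <= J)%E.
    by apply: sume_ge0 => i _; apply: integral_ge0 => x _; rewrite lee_fin cone_ge0.
  have Jfin : J \is a fin_num.
    rewrite ge0_fin_numE//; apply: le_lt_trans (ltry (n.+2%:R * (2 / 3 * l ^+ 3))).
    apply: le_trans C; rewrite leeDl// lee_fin sumr_ge0// => i _.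
    by rewrite mulr_ge0 ?exprn_ge0 ?le_max ?lexx ?orbT//; lra.
  move: C AI; rewrite -(fineK Jfin) -EFinD lee_fin => C.
  rewrite -leeBlDr// -EFinB; apply: le_trans; rewrite lee_fin /B -[n.+2%:R]natr1 in C *.
  by rewrite /Hi in C *; lra.
have H : f * (3 * w ^+ 2) * (1 - 2 / 3 * (h + u) ^+ 3 / G / n.+1%:R) <=
  f / S * (n.+1%:R + kappa * B) + kappa * r * f / n.+1%:R * (2 * \sum_i Hi i).
  apply: cost_algebra SE _ GN => //; first by rewrite ler1n.
  rewrite /B lerD2l -[leRHS]mulr_sumr; apply: ler_wpM2l; first lra.
  have -> : n.+1%:R * (y * u) ^+ 3 + 3 * (y * u) ^+ 2 * (n.+1%:R * (y * h) - \sum_i Hi i) =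
     \sum_(i < n.+1) ((y * u) ^+ 3 + 3 * (y * u) ^+ 2 * (l - Hi i - y * u)).
    rewrite big_split/= sumr_const card_ord -[X in _ = _ + X]mulr_sumr -[X in _ = X + _]mulr_natl; congr (_ + _ * _).
    rewrite [RHS](eq_bigr (fun i => y * h - Hi i)); last by move=> i _; rewrite /l; ring.
    by rewrite [RHS]sumrB sumr_const card_ord -[X in _ = X - _]mulr_natl.
  apply: ler_sum => i _; apply: pos_cube_tangent; by rewrite mulr_ge0 ?(ltW y0).
move: H; rewrite -lee_fin => H; apply: le_trans H _; rewrite /partial_cost.
have -> : (\sum_(i < n.+1) area (region D (tour D i)) = S%:E)%E.
  by rewrite /S -sumEFin; apply: eq_bigr => i _; exact: sE.
rewrite inver gt_eqF// -EFinM.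
rewrite sum_travel; last exact: l1normB.
have -> : \sum_(i < n.+1) l1norm (tour D i - tour D (ord_pred i)) = 2 * \sum_i Hi i.
  by rewrite mulr_sumr; apply: eq_bigr => i _; rewrite /Hi mulrA divff// mul1r.
rewrite EFinD; apply: leeD2r; rewrite (EFinM (f / S) (_ + _)); apply: lee_wpmul2l.
  by rewrite lee_fin divr_ge0// ltW.
rewrite big_split/= -ge0_sume_distrr; last first.
  by move=> i _; apply: integral_ge0 => x _; rewrite lee_fin l1norm_ge0.
rewrite EFinD sumEFin sumr_const card_ord; apply: leeD => //.
by rewrite EFinM; apply: lee_wpmul2l => //; rewrite lee_fin ltW.
Qed.

Lemma cost_ge (D : design_data R) : is_design (@l1norm R) D ->
  ((f * (3 * w ^+ 2))%:E <= cost (@l1norm R) f kappa r D)%E.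
Proof.
move=> dD.
have G0 : 0 < G.
  have k0 : 0 < kappa * G by rewrite -w_cube mulr_gt0// exprn_gt0.
  by rewrite -(pmulr_rgt0 _ kappa_gt0).
pose v n : \bar R := (f * (3 * w ^+ 2) * (1 - 2 / 3 * (h + u) ^+ 3 / G / n%:R))%:E.
have vl : v @ \oo --> (f * (3 * w ^+ 2))%:E.
  apply: cvg_EFin; first exact: nearW.
  rewrite -[X in _ --> X]mulr1; apply: cvgM; first exact: cvg_cst.
  rewrite -[X in _ --> X]subr0; apply: cvgB; first exact: cvg_cst.
  rewrite -(@cvg_shiftS _); exact: cvg_invS.
rewrite -(cvg_limn_einf_sup vl).1; apply: le_limn_einf.
(* from here on the factor 1 - O(1/N) is nonnegative *)
pose m := Num.truncn (2 / 3 * (h + u) ^+ 3 / G).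
exists m.+1 => // -[//|n] /= mn; apply: partial_cost_ge => //.
rewrite -ler_pdivrMr//; apply: ltW; apply: lt_le_trans (truncnS_gt _) _.
by rewrite ler_nat.
Qed.

End design_lower_bound.

(** * The hexagonal lattice *)

Section lattice.
Context (R : realType).
Variables (h u : R).
Hypotheses (h_gt0 : 0 < h) (u_ge0 : 0 <= u).
Let v_gt0 : 0 < h + 2 * u. Proof. by rewrite ltr_wpDr ?mulr_ge0. Qed.

Definition site (k n : int) : R * R := (h * (2 * k + n)%:~R, (h + 2 * u) * n%:~R).

Definition lattice : set (R * R) := [set p | exists k n, p = site k n].

Lemma normM_ge (c : R) (z : int) (m : nat) : 0 <= c -> (m%:Z <= `|z|)%R -> c * m%:R <= `|c * z%:~R|.
Proof.
move=> c0 mz; rewrite normrM ger0_norm//; apply: ler_wpM2l => //.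
by rewrite -intr_norm -[m%:R]/(m%:Z%:~R) ler_int.
Qed.

(** Sites in consecutive rows are at distance at least [h + (h + 2 u)], and sites
    at least two rows apart at distance at least [2 (h + 2 u)]. *)
Lemma site_separated k n k' n' : site k n <> site k' n' ->
  2 * (h + u) <= l1norm (site k n - site k' n') \/
  (site k n).2 = (site k' n').2 /\ 2 * h <= `|(site k n).1 - (site k' n').1|.
Proof.
have h0 := h_gt0; have u0 := u_ge0.
move=> ne; rewrite /l1norm/= -!mulrBr -!intrB.
have -> : 2 * k + n - (2 * k' + n') = 2 * (k - k') + (n - n') by ring.
have [n0|n0] := eqVneq n n'.
  right; split; first by rewrite n0.
  rewrite n0 subrr addr0 mulrC; apply: normM_ge; first exact: ltW.
  have : k != k' by apply/eqP => k0; apply: ne; rewrite n0 k0.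
  lia.
have b0 : n - n' != 0 by lia.
move: (k - k') (n - n') b0 => a b b0.
left; have [b1|b1] := leP 2 `|b|.
  have := @normM_ge (h + 2 * u) b 2 (ltW v_gt0) b1.
  have := normr_ge0 (h * (2 * a + b)%:~R); lra.
have := @normM_ge (h + 2 * u) b 1 (ltW v_gt0).
have := @normM_ge h (2 * a + b) 1 (ltW h_gt0).
have a1 : (1%:Z <= `|(2 * a + b)%R|)%R by lia.
have b1' : (1%:Z <= `|b|)%R by lia.
move=> /(_ a1) H1 /(_ b1') H2; lra.
Qed.

Lemma l1norm_triangle (x y z : R * R) : l1norm (x - z) <= l1norm (x - y) + l1norm (y - z).
Proof.
rewrite /l1norm/=; have := ler_distD y.1 x.1 z.1; have := ler_distD y.2 x.2 z.2; lra.
Qed.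

Lemma cell_nearest p q x : lattice p -> lattice q -> cell p h (h + u) x ->
  l1norm (x - p) <= l1norm (x - q).
Proof.
have h0 := h_gt0; have u0 := u_ge0.
move=> [k [n ->]] [k' [n' ->]] [x1 xl].
have [->//|/site_separated] := pselect (site k n = site k' n').
have := l1norm_triangle (site k n) x (site k' n'); rewrite (l1normB _ x).
move=> tri; case=> [|[e2 e1]]; first by move: tri xl; lra.
move: (site k n) (site k' n') x1 e2 e1 {xl tri} => a b x1 e2 e1.
have := ler_distD x.1 a.1 b.1; rewrite /l1norm/= e2 [`|a.1 - x.1|]distrC; lra.
Qed.

(** The boundary lies in the difference of two cells whose sizes differ by [d],
    which has area [O(d)]. *)
Lemma cell_boundary_null (c : R * R) (A : set (R * R)) :
  lebesgue_measurable A ->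
  (forall x, A x -> cell c h (h + u) x /\ (`|x.1 - c.1| = h \/ l1norm (x - c) = h + u)) ->
  area A = 0%E.
Proof.
have h0 := h_gt0; have u0 := u_ge0.
move=> mA sub; apply/eqP; rewrite eq_le measure_ge0 andbT; apply/lee_addgt0Pr => e e0.
rewrite add0e.
(* the difference of the cells has area at most 4 (h + u) d *)
pose d := Num.min h (e / (4 * (h + u))).
have l0 : 0 < h + u by lra.
have d0 : 0 < d by rewrite lt_min h_gt0/= divr_gt0// mulr_gt0.
have dh : d <= h by rewrite ge_min lexx.
have de : d * (4 * (h + u)) <= e by rewrite -ler_pdivlMr ?mulr_gt0// ge_min lexx orbT.
have mC a l : lebesgue_measurable (cell c a l) by exact: borel_lebesgue (measurable_cell _ _ _).
apply: (@le_trans _ _ (area (cell c h (h + u) `\` cell c (h - d) (h + u - d)))).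
  apply: le_measure; rewrite ?inE//.
    by apply: measurableD; exact: mC.
  move=> x /sub[xc xb]; split => // -[/= x1 xl]; move: xb => -[]; lra.
rewrite measureD//=; last 3 first.
- exact: mC.
- exact: mC.
- by rewrite [X in (X < _)%E]area_cell ?ltry//; apply/andP; split; lra.
rewrite setIidr; last by move=> x [/= ? ?]; split => /=; lra.
rewrite [X in (X - _)%E]area_cell; last by apply/andP; split; lra.
rewrite [X in (_ - X)%E]area_cell; last by apply/andP; split; lra.
rewrite -EFinB lee_fin; nra.
Qed.

Lemma cell_overlap_null p q : lattice p -> lattice q -> p <> q ->
  area (cell p h (h + u) `&` cell q h (h + u)) = 0%E.
Proof.
have h0 := h_gt0; have u0 := u_ge0.
move=> [k [n ->]] [k' [n' ->]] /site_separated sep.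
apply: (@cell_boundary_null (site k n)).
  by apply: measurableI; exact: borel_lebesgue (measurable_cell _ _ _).
move=> x [[x1 xl] [y1 yl]]; split; first by split.
case: sep => [sep|[_ sep]]; [right|left].
  have := l1norm_triangle (site k n) x (site k' n'); rewrite (l1normB _ x).
  by move: xl yl => /=; lra.
have := ler_distD x.1 (site k n).1 (site k' n').1.
by rewrite [`|(site k n).1 - x.1|]distrC; move: x1 y1 sep => /=; lra.
Qed.

Lemma nearest_int (c x : R) : 0 < c -> exists z : int, `|x - 2 * c * z%:~R| <= c.
Proof.
move=> c0; exists (Num.floor (x / (2 * c) + 2^-1)).
have := floor_le_tmp (x / (2 * c) + 2^-1); have := floorD1_gt (x / (2 * c) + 2^-1).
set z := Num.floor _; rewrite intrD => zu zl.
have c2 : 0 < 2 * c by rewrite mulr_gt0.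
have xE : x = 2 * c * (x / (2 * c)) by rewrite mulrC divfK// gt_eqF.
have : 0 <= 2 * c * (x / (2 * c) + 2^-1 - z%:~R) by rewrite mulr_ge0 ?(ltW c2)//; lra.
have : 0 <= 2 * c * (z%:~R + 1 - (x / (2 * c) + 2^-1)) by rewrite mulr_ge0 ?(ltW c2)//; lra.
by rewrite ler_norml => ? ?; apply/andP; split; lra.
Qed.

(** Rounding both coordinates gives a site that can only fail the bound on the
    norm. In that case the point is near a corner of the rounding rectangle, and
    that corner is a site whose cell contains the point. *)
Lemma cell_cover x : exists2 p, lattice p & cell p h (h + u) x.
Proof.
have h0 := h_gt0; have u0 := u_ge0.
have [n n2] := @nearest_int ((h + 2 * u) / 2) x.2 (divr_gt0 v_gt0 (ltr0Sn R 1)).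
have {}n2 : `|x.2 - (h + 2 * u) * n%:~R| <= (h + 2 * u) / 2.
  by rewrite [X in _ - X * _](_ : _ = 2 * ((h + 2 * u) / 2))//; field.
have [k k1] := nearest_int (x.1 - h * n%:~R) h_gt0.
have {}k1 : `|x.1 - h * (2 * k + n)%:~R| <= h.
  by rewrite (_ : x.1 - _ = x.1 - h * n%:~R - 2 * h * k%:~R)// intrD intrM; ring.
have [xl|xl] := leP (l1norm (x - site k n)) (h + u).
  by exists (site k n); [exists k, n|].
move: xl; rewrite /l1norm/=.
have key (s t : int) (a b : R) : 
    (`|a - h * s%:~R| <= h - `|a|) -> `|b - (h + 2 * u) * t%:~R| <= h + 2 * u - `|b| ->
    h + u < `|a| + `|b| -> forall k', 2 * k' + (n + t) = 2 * k + n + s ->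
    a = x.1 - h * (2 * k + n)%:~R -> b = x.2 - (h + 2 * u) * n%:~R ->
    exists2 p, lattice p & cell p h (h + u) x.
  move=> ha hb hab k' kE aE bE; exists (site k' (n + t)); first by exists k', (n + t).
  rewrite /cell/= /l1norm/=.
  rewrite kE (_ : x.1 - _ = a - h * s%:~R); last by rewrite aE intrD; ring.
  rewrite (_ : x.2 - _ = b - (h + 2 * u) * t%:~R); last by rewrite bE [in LHS]intrD; ring.
  by have := normr_ge0 a; lra.
set a := x.1 - _; set b := x.2 - _ => hab.
have ah : `|a| <= h by [].
have bh : `|b| <= (h + 2 * u) / 2 by [].
have step (c w : R) : `|c| <= w -> exists2 s : int, s = 1 \/ s = -1 & `|c - w * s%:~R| <= w - `|c|.
  move=> cw; have [c0|/ltW c0] := leP 0 c.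
    exists 1; [by left|]; rewrite mulr1; move: cw; rewrite ger0_norm// => cw.
    by rewrite ler0_norm; lra.
  exists (-1); [by right|]; rewrite mulrN1 opprK; move: cw; rewrite ler0_norm// => cw.
  by rewrite ger0_norm; lra.
have [s sE hs] := step a h ah.
have [t tE ht] : exists2 s : int, s = 1 \/ s = -1 & `|b - (h + 2 * u) * s%:~R| <= h + 2 * u - `|b|.
  by apply: step; lra.
have [k' k'E] : exists k', 2 * k' + (n + t) = 2 * k + n + s.
  case: sE => ->; case: tE => ->.
  - by exists k; ring.
  - by exists (k + 1); ring.
  - by exists (k - 1); ring.
  - by exists k; ring.
exact: (key s t a b hs ht hab k' k'E).
Qed.

End lattice.

(** * Discs and annuli *)

Section discs.
Context (R : realType).
Local Notation mR := (measurableTypeR R).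
Local Notation mu := (@lebesgue_measure R).

Lemma discP (rho : R) (x : R * R) : 0 <= rho ->
  disc rho x <-> x.1 ^+ 2 + x.2 ^+ 2 <= rho ^+ 2.
Proof.
move=> rho0; rewrite /disc/= -{1}(ger0_norm rho0) -sqrtr_sqr; split=> h.
  by move: h; rewrite ler_sqrt// sqr_ge0.
by apply: ler_wsqrtr.
Qed.

Lemma measurable_disc (rho : R) : measurable (disc rho : set (mR * mR)).
Proof.
have mf : measurable_fun [set: mR * mR] (fun x => Num.sqrt (x.1 ^+ 2 + x.2 ^+ 2) : R).
  apply: measurableT_comp; first exact: continuous_measurable_fun (@sqrt_continuous R).
  apply: measurable_funD; apply: measurable_funX; [exact: measurable_fst|exact: measurable_snd].
have := mf measurableT `]-oo, rho]%classic (measurable_itv _).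
by rewrite setTI set_itvE.
Qed.

Lemma sqrtB_le (a b : R) : 0 <= b <= a -> Num.sqrt a - Num.sqrt b <= Num.sqrt (a - b).
Proof.
move=> /andP[b0 ba]; have ab0 : 0 <= a - b by lra.
rewrite lerBlDr -ler_sqr ?nnegrE ?addr_ge0 ?sqrtr_ge0// sqrrD !sqr_sqrtr//; last lra.
have : 0 <= Num.sqrt (a - b) * Num.sqrt b by rewrite mulr_ge0 ?sqrtr_ge0.
lra.
Qed.

Lemma lebesgue_segment (c d : R) : c <= d -> mu `[c, d] = (d - c)%:E.
Proof.
rewrite le_eqVlt => /predU1P[->|cd]; first by rewrite lebesgue_measure_itv/= ltxx subrr.
by rewrite lebesgue_measure_itv/= lte_fin cd.
Qed.

(** The two half-chords are [Num.sqrt a] and [Num.sqrt b] with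
    [a - b <= 2 rho e + e^2], and [sqrtB_le] bounds their difference. *)
Lemma section_annulus_le (rho e x : R) : 0 <= rho -> 0 <= e -> `|x| <= rho + e ->
  (mu (xsection (disc (rho + e) `\` disc rho) x) <= (2 * Num.sqrt (2 * rho * e + e ^+ 2))%:E)%E.
Proof.
move=> r0 e0 xr.
(* the section lies in the set of y with b <= y^2 <= a, where b = 0 if |x| > rho *)
pose b := Num.max 0 (rho ^+ 2 - x ^+ 2); pose a := (rho + e) ^+ 2 - x ^+ 2.
have a0 : 0 <= a by rewrite subr_ge0 -(real_normK (num_real x)) lerXn2r ?nnegrE// addr_ge0.
have b0 : 0 <= b by rewrite le_max lexx.
have ba : b <= a by rewrite /b ge_max a0 /a; nra.
have sub : xsection (disc (rho + e) `\` disc rho) x `<=`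
    `[- Num.sqrt a, - Num.sqrt b] `|` `[Num.sqrt b, Num.sqrt a].
  move=> y /xsectionP[/discP/= hy1 /discP/= hy2].
  have ya : y ^+ 2 <= a by rewrite /a; have := hy1 (addr_ge0 r0 e0); lra.
  have yb : b <= y ^+ 2.
    rewrite ge_max sqr_ge0/=; case: (leP (x ^+ 2 + y ^+ 2) (rho ^+ 2)) => [h|]; last lra.
    by case: (hy2 r0 h).
  have {ya} : `|y| <= Num.sqrt a by rewrite -sqrtr_sqr ler_wsqrtr.
  have {yb} : Num.sqrt b <= `|y| by rewrite -sqrtr_sqr ler_wsqrtr.
  rewrite /= !in_itv/=; case: (leP 0 y) => y0.
    by rewrite ger0_norm// => h1 h2; right; apply/andP.
  by rewrite ltr0_norm// => h1 h2; left; apply/andP; split; lra.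
have mS : measurable (xsection (disc (rho + e) `\` disc rho : set (mR * mR)) x).
  by apply: measurable_xsection; apply: measurableD; exact: measurable_disc.
apply: (@le_trans _ _ (mu (`[- Num.sqrt a, - Num.sqrt b] `|` `[Num.sqrt b, Num.sqrt a]))).
  by apply: le_measure => //; rewrite inE//; exact: measurableU.
apply: le_trans (measureU2 _ _ _) _ => //.
have sba : Num.sqrt b <= Num.sqrt a by rewrite ler_wsqrtr.
rewrite [X in (X + _)%E]lebesgue_segment ?lerN2//.
rewrite [X in (_ + X)%E]lebesgue_segment// -EFinD lee_fin.
have := @sqrtB_le a b; rewrite b0 ba => /(_ isT) h.
have : Num.sqrt (a - b) <= Num.sqrt (2 * rho * e + e ^+ 2).
  apply: ler_wsqrtr; rewrite /a lerBlDr.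
  have : rho ^+ 2 - x ^+ 2 <= b by rewrite le_max lexx orbT.
  lra.
lra.
Qed.

Lemma area_annulus_le (rho e : R) : 0 <= rho -> 0 <= e ->
  (area (disc (rho + e) `\` disc rho) <= (4 * (rho + e) * Num.sqrt (2 * rho * e + e ^+ 2))%:E)%E.
Proof.
move=> r0 e0.
have mB : measurable (disc (rho + e) `\` disc rho : set (mR * mR)).
  by apply: measurableD; exact: measurable_disc.
rewrite (areaE mB) /= /product_measure1/=.
set s := Num.sqrt _; have s0 : 0 <= s by exact: sqrtr_ge0.
apply: (@le_trans _ _ (\int[mu]_(x in `[(- (rho + e))%R, (rho + e)%R]) (cst (2 * s)%:E x))%E).
  rewrite [leRHS]integral_mkcond; apply: ge0_le_integral => //.
  - exact: measurable_fun_xsection.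
  - by apply: (iffLR (measurable_restrictT _ _)) => //; exact: measurable_cst.
  move=> x _; rewrite patchE/=; case: ifPn => [|/negP]; rewrite inE/= in_itv/= => xr.
    by apply: section_annulus_le => //; rewrite ler_norml.
  rewrite (_ : xsection _ x = set0) ?measure0//.
  rewrite -subset0 => y /xsectionP[/discP/= hy _]; apply: xr.
  rewrite -ler_norml -ler_sqr ?nnegrE ?addr_ge0// real_normK ?num_real//.
  by have := hy (addr_ge0 r0 e0); have := sqr_ge0 y; lra.
rewrite integral_cst// [X in (_ * X)%E]lebesgue_segment; last by move: r0 e0; lra.
by rewrite -EFinM lee_fin; lra.
Qed.

Lemma area_disc_ge (rho : R) : 0 <= rho -> ((2 * rho ^+ 2)%:E <= area (disc rho))%E.
Proof.
move=> r0; have -> : (2 * rho ^+ 2)%:E = area (cell (0 : R * R) rho rho).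
  by rewrite area_cell ?lexx ?r0//; congr (_%:E); ring.
apply: le_measure; rewrite ?inE.
- exact: borel_lebesgue (measurable_cell _ _ _).
- exact: borel_lebesgue (measurable_disc _).
move=> x [_]; rewrite subr0 /l1norm => xl; apply/discP => //.
rewrite -(real_normK (num_real x.1)) -(real_normK (num_real x.2)).
have : 0 <= `|x.1| * `|x.2| by rewrite mulr_ge0.
have : (`|x.1| + `|x.2|) ^+ 2 <= rho ^+ 2 by rewrite lerXn2r ?nnegrE ?addr_ge0.
lra.
Qed.

(** The Euclidean norm is bounded by [l1norm]. *)
Lemma disc_l1norm (rho l : R) (x p : R * R) : 0 <= rho -> l1norm (x - p) <= l ->
  disc rho p -> disc (rho + l) x.
Proof.
move=> r0 xl /discP => /(_ r0) hp.
have l0 : 0 <= l by apply: le_trans xl; exact: l1norm_ge0.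
apply/discP; first exact: addr_ge0.
move: xl; rewrite /l1norm/= => xl.
have p1 : `|p.1| <= rho.
  by rewrite -ler_sqr ?nnegrE// real_normK ?num_real//; have := sqr_ge0 p.2; lra.
have p2 : `|p.2| <= rho.
  by rewrite -ler_sqr ?nnegrE// real_normK ?num_real//; have := sqr_ge0 p.1; lra.
set a := x.1 - p.1 in xl; set b := x.2 - p.2 in xl.
have -> : x.1 = p.1 + a by rewrite /a; ring.
have -> : x.2 = p.2 + b by rewrite /b; ring.
have h1 : p.1 * a <= rho * `|a|.
  by apply: le_trans (ler_norm _) _; rewrite normrM ler_wpM2r.
have h2 : p.2 * b <= rho * `|b|.
  by apply: le_trans (ler_norm _) _; rewrite normrM ler_wpM2r.
have h3 : a ^+ 2 + b ^+ 2 <= l ^+ 2.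
  rewrite -(real_normK (num_real a)) -(real_normK (num_real b)).
  have : 0 <= `|a| * `|b| by rewrite mulr_ge0.
  have : (`|a| + `|b|) ^+ 2 <= l ^+ 2 by rewrite lerXn2r ?nnegrE ?addr_ge0.
  lra.
have h4 : rho * (`|a| + `|b|) <= rho * l by apply: ler_wpM2l.
lra.
Qed.

End discs.

(** * Sweeping a disc row by row *)

Section path_length.
Context (R : realType) (T : Type) (d : T -> T -> R).

Fixpoint path_length (x : T) (s : seq T) : R :=
  if s is y :: s' then d x y + path_length y s' else 0.

Lemma path_length_cat x s1 s2 :
  path_length x (s1 ++ s2) = path_length x s1 + path_length (last x s1) s2.
Proof. by elim: s1 x => [|y s1 IH] x /=; rewrite ?add0r// IH addrA. Qed.

Lemma path_length_map_iota (f : nat -> T) (c : R) x a n :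
  (forall i, d (f i) (f i.+1) = c) ->
  path_length x [seq f i | i <- iota a n.+1] = d x (f a) + c * n%:R.
Proof.
move=> dc; elim: n a x => [|n IH] a x /=; first by rewrite mulr0.
by move: (IH a.+1 (f a)) => /= ->; rewrite dc -natr1; ring.
Qed.

Lemma path_length_rows (f : nat -> nat -> T) (w : nat -> nat) (c J : R) x a n :
  (forall y z, 0 <= d y z) -> 0 <= c -> 0 <= J ->
  (forall t i, d (f t i) (f t i.+1) = c) -> (forall t, 0 < w t)%N ->
  (forall t, (a <= t)%N -> (t.+1 < a + n)%N -> d (f t (w t).-1) (f t.+1 0) <= J) ->
  path_length x [seq f t i | t <- iota a n, i <- iota 0 (w t)] <=
  d x (f a 0%N) + c * (size [seq f t i | t <- iota a n, i <- iota 0 (w t)])%:R + J * n%:R.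
Proof.
move=> d0 c0 J0 dc w0; elim: n a x => [|n IH] a x jump.
  by rewrite /= !mulr0 !addr0.
rewrite [iota a n.+1]/= allpairs_cons path_length_cat size_cat size_map size_iota natrD.
have [k wk] : exists k, w a = k.+1 by exists (w a).-1; rewrite prednK.
rewrite wk (path_length_map_iota _ _ _ (dc a)).
have lastE : last x [seq f a y | y <- iota 0 k.+1] = f a k.
  rewrite (last_nth x) size_map size_iota.
  rewrite -[nth x _ _]/(nth x [seq f a y | y <- iota 0 k.+1] k).
  by rewrite (nth_map 0%N) ?size_iota// nth_iota.
rewrite lastE; case: n IH jump => [|n] IH jump.
  by rewrite /= -natr1; move: c0 J0; lra.
have jump' t : (a < t)%N -> (t.+1 < a.+1 + n.+1)%N -> d (f t (w t).-1) (f t.+1 0) <= J.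
  by move=> at1; rewrite addSnnS; apply: jump; exact: ltnW.
have := IH a.+1 (f a k) jump'.
have an : (a.+1 < a + n.+2)%N by lia.
have := jump a (leqnn a) an; rewrite wk /=.
rewrite -[n.+2%:R]natr1 -[k.+1%:R]natr1; lra.
Qed.

End path_length.

(** Starting from the last point accounts for the closing leg. *)
Lemma path_length_cyclic (R : realType) (T : Type) (d : T -> T -> R) (x0 : T) (s : seq T) n :
  size s = n.+1 ->
  \sum_(i < n.+1) d (nth x0 s (ord_pred i)) (nth x0 s i) = path_length d (last x0 s) s.
Proof.
case: s => [//|y s] [sn]; rewrite big_ord_recl/=; congr (d _ _ + _).
  by rewrite (last_nth x0) sn modn_small.
have gen z (r : seq T) : \sum_(i < size r) d (nth x0 (z :: r) i) (nth x0 r i) = path_length d z r.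
  elim: r z => [|z' r IH] z; first by rewrite big_ord0.
  by rewrite big_ord_recl /= IH.
rewrite -gen sn; apply: eq_bigr => i _; congr (d (nth _ _ _) _).
by rewrite add0n modnDr modn_small// ltnS ltnW.
Qed.

Section boustrophedon.
Context (R : realType).
Variables (h u : R).
Hypotheses (h_gt0 : 0 < h) (u_ge0 : 0 <= u).

Definition site_of (p : int * int) : R * R := site h u p.1 p.2.

Definition rows (m : nat) : nat := Num.truncn (m%:R / (h + 2 * u)).

Definition chord (m : nat) (n : int) : R :=
  Num.sqrt (m%:R ^+ 2 - ((h + 2 * u) * n%:~R) ^+ 2).

(** A row starts up to half a step away from the vertical axis; this and the
    rounding are made up for by the two additional sites on either side. *)
Definition half_width (m : nat) (n : int) : nat := (Num.truncn (chord m n / (2 * h))).+2.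

Definition row_of (m t : nat) : int := t%:Z - (rows m)%:Z.

(** Rows of odd number are run through backwards, so that every row starts near
    the end of the row before it. *)
Definition tour_index (m t i : nat) : int * int :=
  let n := row_of m t in let K := (half_width m n)%:Z in
  ((if odd t then K - 1 - i%:Z else i%:Z - K) - (n %/ 2)%Z, n).

Definition block (m : nat) : seq (int * int) :=
  [seq tour_index m t i | t <- iota 0 (rows m).*2.+1,
                     i <- iota 0 (half_width m (row_of m t)).*2].

(** These sites bring a block up to the required size; they fill the row above it. *)
Definition extra (m i : nat) : int * int :=
  (i%:Z - ((rows m).+1%:Z %/ 2)%Z, (rows m).+1%:Z).

Definition tour_indices (m N : nat) : seq (int * int) :=
  take N (block m ++ [seq extra m i | i <- iota 0 N]).

Lemma size_tour_indices m N : size (tour_indices m N) = N.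
Proof. by rewrite size_takel// size_cat size_map size_iota leq_addl. Qed.

Lemma site_inj k n k' n' : site h u k n = site h u k' n' -> k = k' /\ n = n'.
Proof.
have v0 : 0 < h + 2 * u by rewrite ltr_wpDr ?mulr_ge0.
rewrite /site => -[/(mulfI (lt0r_neq0 h_gt0)) e1 /(mulfI (lt0r_neq0 v0)) /intr_inj e2].
by move: e1 => /intr_inj; lia.
Qed.

Lemma site_of_inj : injective site_of.
Proof. by move=> [k n] [k' n'] /site_inj[/= -> ->]. Qed.

Lemma mem_block_row m p : p \in block m -> `|p.2| <= (rows m)%:Z.
Proof.
move=> /allpairsPdep[t [i [+ _ ->]]]; rewrite mem_iota /tour_index/row_of/=.
by move=> tr; lia.
Qed.

Lemma uniq_block m : uniq (block m).
Proof.
apply: allpairs_uniq_dep; first exact: iota_uniq.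
  by move=> t _; exact: iota_uniq.
move=> [t i] [t' i'] _ _ /= [] + /eqP; rewrite /row_of.
move=> + /eqP tt; have {tt}-> : t = t' by lia.
case: ifP => _ e; have -> // : i = i'.
  by move: e; set c := (_ %/ _)%Z; lia.
by move: e; set c := (_ %/ _)%Z; lia.
Qed.

Lemma uniq_tour_indices m N : uniq (tour_indices m N).
Proof.
apply: take_uniq; rewrite cat_uniq uniq_block/=; apply/andP; split.
  apply/hasPn => _ /mapP[i _ ->]; apply/negP => /mem_block_row/=; lia.
by rewrite map_inj_uniq ?iota_uniq// => i j [] /addIr; lia.
Qed.

Let v_gt0 : 0 < h + 2 * u.
Proof. by rewrite ltr_wpDr ?mulr_ge0. Qed.

Lemma rows_le m : (rows m)%:R * (h + 2 * u) <= m%:R.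
Proof. by rewrite -ler_pdivlMr// truncn_le divr_ge0// ltW. Qed.

Lemma row_sqr_le m (n : int) : `|n| <= (rows m)%:Z -> ((h + 2 * u) * n%:~R) ^+ 2 <= m%:R ^+ 2.
Proof.
move=> nr; rewrite -(real_normK (num_real (_ * _))) lerXn2r ?nnegrE//.
rewrite normrM (gtr0_norm v_gt0) mulrC; apply: le_trans (rows_le m).
by apply: ler_wpM2r; [exact: ltW|rewrite -intr_norm -[(rows m)%:R]/((rows m)%:Z%:~R) ler_int].
Qed.

Lemma block_row_width m p : p \in block m ->
  `|2 * p.1 + p.2| <= 2 * (half_width m p.2)%:Z.
Proof.
move=> /allpairsPdep[t [i [_ + ->]]]; rewrite mem_iota add0n /tour_index/=.
move: (row_of m t) => n.
move: (half_width m n) => K; case: ifP => _ iK; lia.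
Qed.

Lemma mem_block_disc m p : p \in block m -> disc (m%:R + 4 * h) (site_of p).
Proof.
have h0 := h_gt0.
move=> pb; have w := block_row_width pb; have r := mem_block_row pb.
apply/discP; first by rewrite addr_ge0// mulr_ge0// ltW.
rewrite /site_of/=; set E := chord m p.2.
have E0 : 0 <= E by exact: sqrtr_ge0.
have EE : E ^+ 2 = m%:R ^+ 2 - ((h + 2 * u) * p.2%:~R) ^+ 2.
  by rewrite sqr_sqrtr// subr_ge0; exact: row_sqr_le.
have Em : E <= m%:R.
  by rewrite -ler_sqr ?nnegrE// EE lerBlDr lerDl sqr_ge0.
have x1 : `|h * (2 * p.1 + p.2)%:~R| <= E + 4 * h.
  rewrite normrM (gtr0_norm h0) -intr_norm.
  apply: (@le_trans _ _ (h * (2 * (half_width m p.2)%:Z)%:~R)).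
    by rewrite ler_pM2l// ler_int.
  rewrite intrM -[(half_width m p.2)%:Z%:~R]/((half_width m p.2)%:R).
  have t0 : 0 <= E / (2 * h) by rewrite divr_ge0// mulr_ge0// ltW.
  have := t0; rewrite -truncn_le => tE.
  have : (half_width m p.2)%:R <= E / (2 * h) + 2.
    by rewrite /half_width -/E -addn2 natrD lerD2r.
  rewrite -(ler_pM2l (_ : 0 < 2 * h)); last by rewrite mulr_gt0.
  have : 2 * h * (E / (2 * h)) = E by field; rewrite gt_eqF.
  by move=> e1; rewrite [X in _ <= X -> _]mulrDr e1; lra.
have : (h * (2 * p.1 + p.2)%:~R) ^+ 2 <= (E + 4 * h) ^+ 2.
  by rewrite -(real_normK (num_real (_ * _))) lerXn2r ?nnegrE// addr_ge0// mulr_ge0// ltW.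
have : h * E <= h * m%:R by rewrite ler_pM2l.
by rewrite !sqrrD EE; lra.
Qed.

Lemma disc_mem_block m k n : disc m%:R (site h u k n) -> (k, n) \in block m.
Proof.
have h0 := h_gt0.
move=> /discP => /(_ (ler0n _ _)) /= D.
have nr : `|n| <= (rows m)%:Z.
  rewrite -[`|n|]abszE -[(_ <= _)%R]/((_ <= _)%N) /rows truncn_ge_nat; last first.
    by rewrite divr_ge0// ltW.
  rewrite ler_pdivlMr// -[(`|n|%N)%:R]/((`|n|%N)%:Z%:~R) abszE intr_norm.
  rewrite mulrC -{1}(gtr0_norm v_gt0) -normrM -ler_sqr ?nnegrE// real_normK ?num_real//.
  by have := sqr_ge0 (h * (2 * k + n)%:~R); lra.
have wid : `|2 * k + n| < 2 * (half_width m n)%:Z - 2.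
  have hw : chord m n / (2 * h) + 1 < (half_width m n)%:R.
    by rewrite /half_width -[X in _ < X]natr1 ltrD2r truncnS_gt.
  rewrite -(ltr_int R) intr_norm.
  have -> : (2 * (half_width m n)%:Z - 2)%:~R = 2 * (half_width m n)%:R - 2 :> R.
    by rewrite intrB intrM.
  have hE : `|h * (2 * k + n)%:~R| <= chord m n.
    rewrite -sqrtr_sqr; apply: ler_wsqrtr; lra.
  have : `|(2 * k + n)%:~R| <= chord m n / h.
    by rewrite ler_pdivlMr// mulrC -{1}(gtr0_norm h0) -normrM.
  have : chord m n / h = 2 * (chord m n / (2 * h)) by field; rewrite gt_eqF.
  lra.
apply/allpairsPdep; pose t := absz (n + (rows m)%:Z).
have rowE : row_of m t = n by rewrite /row_of /t; lia.
pose K := half_width m n.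
pose i := if odd t then absz (K%:Z - 1 - k - (n %/ 2)%Z)%R else absz (k + (n %/ 2)%Z + K%:Z)%R.
exists t, i; rewrite !mem_iota /= !add0n /tour_index rowE -/K; split.
- by rewrite /t; lia.
- by move: wid; rewrite /i -/K; case: (odd t); lia.
- by move: wid; rewrite /i -/K; case: (odd t) => wid; congr pair; lia.
Qed.

End boustrophedon.

Section tour_length.
Context (R : realType).
Variables (h u : R).
Hypotheses (h_gt0 : 0 < h) (u_ge0 : 0 <= u).
Let v_gt0 : 0 < h + 2 * u.
Proof. by rewrite ltr_wpDr ?mulr_ge0. Qed.

Definition site_dist (p q : int * int) : R := l1norm (site_of h u p - site_of h u q).

Lemma site_distE p q : site_dist p q =
  h * `|(2 * (p.1 - q.1) + (p.2 - q.2))%:~R| + (h + 2 * u) * `|(p.2 - q.2)%:~R|.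
Proof.
rewrite /site_dist /l1norm/= -!mulrBr !normrM (gtr0_norm h_gt0) (gtr0_norm v_gt0) -!intrB.
by congr (_ * `|_%:~R| + _); ring.
Qed.

Lemma tour_index_step m t i : site_dist (tour_index h u m t i) (tour_index h u m t i.+1) = 2 * h.
Proof.
rewrite site_distE /tour_index/= subrr normr0 mulr0 !addr0.
rewrite -intr_norm mulrC [X in X%:~R](_ : _ = 2)//; case: (odd t); lia.
Qed.

Lemma extra_step m i : site_dist (extra h u m i) (extra h u m i.+1) = 2 * h.
Proof.
rewrite site_distE /extra/= subrr normr0 mulr0 !addr0.
rewrite -intr_norm mulrC [X in X%:~R](_ : _ = 2)//; lia.
Qed.

Definition jump (m : nat) : R := Num.sqrt (2 * (h + 2 * u) * m%:R) + 3 * h + (h + 2 * u).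

(** The squares of two consecutive chords differ by
    [(h + 2 u)^2 |2 n + 1|], which is at most [2 (h + 2 u) m]. *)
Lemma chord_diff m n : `|n| <= (rows h u m)%:Z -> `|n + 1| <= (rows h u m)%:Z ->
  `|chord h u m n - chord h u m (n + 1)| <= Num.sqrt (2 * (h + 2 * u) * m%:R).
Proof.
move=> n0 n1.
have key (a b c : R) : 0 <= a -> 0 <= b -> `|a - b| <= c ->
    `|Num.sqrt a - Num.sqrt b| <= Num.sqrt c.
  move=> a0 b0 abc; case: (leP b a) => [ba|/ltW ab].
    rewrite ger0_norm ?subr_ge0 ?ler_wsqrtr//.
    apply: le_trans (sqrtB_le _) _; first by rewrite b0.
    by apply: ler_wsqrtr; rewrite ger0_norm ?subr_ge0 in abc.
  rewrite distrC ger0_norm ?subr_ge0 ?ler_wsqrtr//.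
  apply: le_trans (sqrtB_le _) _; first by rewrite a0.
  by apply: ler_wsqrtr; rewrite distrC ger0_norm ?subr_ge0 in abc.
apply: key; try by rewrite subr_ge0; exact: row_sqr_le.
rewrite intrD; set v := h + 2 * u; set x := n%:~R.
rewrite (_ : _ - _ = v ^+ 2 * (2 * x + 1)); last by ring.
rewrite normrM ger0_norm ?sqr_ge0//.
have -> : 2 * x + 1 = (2 * n + 1)%:~R by rewrite intrD intrM.
have : `|(2 * n + 1)%:~R| <= 2 * (rows h u m)%:R :> R.
  have -> : 2 * (rows h u m)%:R = (2 * (rows h u m)%:Z)%:~R :> R by rewrite intrM.
  by rewrite -intr_norm ler_int; lia.
rewrite -(ler_pM2l (exprn_gt0 2 v_gt0)) => /le_trans; apply.
have := rows_le h_gt0 u_ge0 m; rewrite -[X in is_true X -> _](ler_pM2l v_gt0) -/v; lra.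
Qed.

Lemma half_width_diff m n : `|n| <= (rows h u m)%:Z -> `|n + 1| <= (rows h u m)%:Z ->
  h * (2 * `|(half_width h u m n)%:R - (half_width h u m (n + 1))%:R| + 1) <=
  Num.sqrt (2 * (h + 2 * u) * m%:R) + 3 * h.
Proof.
move=> n0 n1; have := chord_diff n0 n1; have h0 := h_gt0.
rewrite /half_width; set a := chord _ _ _ n; set b := chord _ _ _ (n + 1).
have a0 : 0 <= a / (2 * h) by rewrite divr_ge0 ?sqrtr_ge0// mulr_ge0// ltW.
have b0 : 0 <= b / (2 * h) by rewrite divr_ge0 ?sqrtr_ge0// mulr_ge0// ltW.
have := truncn_itv a0; have := truncn_itv b0.
move: (Num.truncn (a / (2 * h))) (Num.truncn (b / (2 * h))) => A B /andP[B1 B2] /andP[A1 A2] ab.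
have -> : A.+2%:R - B.+2%:R = A%:R - B%:R :> R by rewrite -(addn2 A) -(addn2 B) !natrD; ring.
rewrite -(natr1 B) in B2; rewrite -(natr1 A) in A2.
have : `|A%:R - B%:R| <= `|a / (2 * h) - b / (2 * h)| + 1.
  have := ler_norm (a / (2 * h) - b / (2 * h)).
  have := ler_norm (- (a / (2 * h) - b / (2 * h))); rewrite normrN => h1 h2.
  by rewrite ler_norml; apply/andP; split; lra.
rewrite -mulrBl normrM (@ger0_norm _ (2 * h)^-1); last by rewrite invr_ge0 mulr_ge0// ltW.
move=> ABd; have := ABd; rewrite -(ler_pM2l (_ : 0 < 2 * h)) ?mulr_gt0//.
have : 2 * h * (`|a - b| / (2 * h)) = `|a - b| by field; rewrite gt_eqF.
by move=> e; rewrite [X in _ <= X -> _]mulrDr e; lra.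
Qed.

Lemma tour_index_jump m t : (t.+1 < (rows h u m).*2.+1)%N ->
  site_dist (tour_index h u m t (half_width h u m (row_of h u m t)).*2.-1)
            (tour_index h u m t.+1 0) <= jump m.
Proof.
move=> tr; have h0 := h_gt0; have v0 := v_gt0.
have rE : row_of h u m t.+1 = row_of h u m t + 1 by rewrite /row_of; lia.
rewrite /tour_index; cbv zeta; rewrite rE; set n := row_of h u m t.
have n0 : `|n| <= (rows h u m)%:Z by rewrite /n /row_of; lia.
have n1 : `|n + 1| <= (rows h u m)%:Z by rewrite /n /row_of; lia.
have := half_width_diff n0 n1.
have : (0 < half_width h u m n)%N by [].
move: (half_width h u m n) (half_width h u m (n + 1)) => K K' K0 HW.
rewrite site_distE /=.
have -> : `|(n - (n + 1))%:~R| = 1 :> R by rewrite -intr_norm (_ : `|_| = 1)//; lia.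
rewrite mulr1 /jump lerD2r; apply: le_trans HW; rewrite ler_pM2l//.
have -> : 2 * `|K%:R - K'%:R| + 1 = (2 * `|K%:Z - K'%:Z| + 1)%:~R :> R.
  by rewrite intrD intrM intr_norm intrB.
by rewrite -intr_norm ler_int; case: (odd t) => /=; lia.
Qed.

Lemma path_block_le m x : path_length site_dist x (block h u m) <=
  site_dist x (tour_index h u m 0 0) + 2 * h * (size (block h u m))%:R +
  jump m * (rows h u m).*2.+1%:R.
Proof.
have h0 := h_gt0; have v0 := v_gt0.
apply: path_length_rows => //.
- by move=> *; exact: l1norm_ge0.
- by rewrite mulr_ge0// ltW.
- by rewrite /jump !addr_ge0 ?sqrtr_ge0 ?mulr_ge0// ltW.
- by move=> t i; exact: tour_index_step.
- by move=> t _ tr; exact: tour_index_jump.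
Qed.

Lemma l1norm_disc (rho : R) x : 0 <= rho -> disc rho x -> l1norm x <= 2 * rho.
Proof.
move=> r0 /discP => /(_ r0) xr.
have x1 : `|x.1| <= rho.
  by rewrite -ler_sqr ?nnegrE// real_normK ?num_real//; have := sqr_ge0 x.2; lra.
have x2 : `|x.2| <= rho.
  by rewrite -ler_sqr ?nnegrE// real_normK ?num_real//; have := sqr_ge0 x.1; lra.
rewrite /l1norm; lra.
Qed.

Lemma site_dist_le p q : site_dist p q <= l1norm (site_of h u p) + l1norm (site_of h u q).
Proof.
have := l1norm_triangle (site_of h u p) 0 (site_of h u q).
by rewrite /site_dist subr0 (l1normB 0) subr0.
Qed.

Lemma l1norm_extra m i : l1norm (site_of h u (extra h u m i)) <=
  2 * h * i%:R + h + m%:R + (h + 2 * u).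
Proof.
have h0 := h_gt0; have v0 := v_gt0.
rewrite /l1norm/= !normrM (gtr0_norm h0) (gtr0_norm v0).
have a1 : `|(2 * (i%:Z - (Posz (rows h u m).+1 %/ 2)%Z) + (rows h u m).+1%:Z)%:~R| <= 2 * i%:R + 1 :> R.
  have -> : 2 * i%:R + 1 = (2 * i%:Z + 1)%:~R :> R by rewrite intrD intrM.
  by rewrite -intr_norm ler_int; lia.
have := rows_le h_gt0 u_ge0 m.
have -> : `|(rows h u m).+1%:~R| = (rows h u m)%:R + 1 :> R.
  by rewrite natr1 -[(rows h u m).+1%:R]/((rows h u m).+1%:Z%:~R) -intr_norm.
move: a1; rewrite -(ler_pM2l h0); lra.
Qed.

(** The last summand pays for the leg from the block to the additional row and
    for the return to the start, which are of order [m] apart from the length of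
    that row. *)
Lemma tour_path_le m N x0 : (size (block h u m) <= N)%N ->
  path_length site_dist (last x0 (tour_indices h u m N)) (tour_indices h u m N) <=
  2 * h * N%:R + 2 * h * (N - size (block h u m))%:R +
  jump m * (rows h u m).*2.+1%:R + (8 * m%:R + 27 * h + 2 * (h + 2 * u)).
Proof.
have h0 := h_gt0; have v0 := v_gt0.
move=> MN; set e := (N - _)%N.
have NE : N%:R = (size (block h u m))%:R + e%:R :> R by rewrite -natrD /e subnKC.
have sE : tour_indices h u m N = block h u m ++ [seq extra h u m i | i <- iota 0 e].
  by rewrite /tour_indices take_cat ltnNge MN/= -map_take take_iota (minn_idPl _)// leq_subr.
have [z [s bE]] : exists z s, block h u m = z :: s.
  by rewrite /block/= ; eexists; eexists.
have b_le p : p \in block h u m -> l1norm (site_of h u p) <= 2 * (m%:R + 4 * h).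
  move=> /mem_block_disc pb; apply: l1norm_disc; last exact: pb.
  by rewrite addr_ge0// mulr_ge0// ltW.
have lb y : last y (block h u m) \in block h u m by rewrite bE /= mem_last.
have i00 : tour_index h u m 0 0 \in block h u m.
  by rewrite /block/= in_cons eqxx.
have ext_le i : (i < e)%N -> l1norm (site_of h u (extra h u m i)) <=
    2 * h * e%:R + h + m%:R + (h + 2 * u).
  move=> ie; apply: le_trans (l1norm_extra m i) _.
  have : i%:R <= e%:R :> R by rewrite ler_nat ltnW.
  by rewrite -(ler_pM2l (_ : 0 < 2 * h)) ?mulr_gt0//; lra.
rewrite {2}sE path_length_cat; set y := last _ (tour_indices _ _ _ _).
have y_le : l1norm (site_of h u y) <= 2 * (m%:R + 4 * h) + (2 * h * e%:R + h + m%:R + (h + 2 * u)).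
  have eh : 0 <= 2 * h * e%:R by rewrite !mulr_ge0// ltW.
  have m0 : 0 <= m%:R :> R by [].
  rewrite /y sE last_cat; case: (e) eh ext_le => [|k] eh ext_le.
    have := b_le _ (lb x0) => /=; lra.
  rewrite [iota _ _]/= map_cons [last _ _]/= last_map.
  have : last 0%N (iota 1 k) \in iota 0 k.+1 by rewrite -[iota 0 k.+1]/(0%N :: iota 1 k) mem_last.
  rewrite mem_iota /= add0n => /ext_le; lra.
have P1 := path_block_le m y.
have P2 := site_dist_le y (tour_index h u m 0 0).
have P3 := b_le _ i00.
have P4 : path_length site_dist (last y (block h u m)) [seq extra h u m i | i <- iota 0 e] <=
    2 * (m%:R + 4 * h) + (h + m%:R + (h + 2 * u)) + 2 * h * e%:R.
  have m0 : 0 <= m%:R :> R by [].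
  case: (e) => [|k]; first by rewrite /=; lra.
  rewrite (path_length_map_iota _ _ _ (extra_step m)).
  have := site_dist_le (last y (block h u m)) (extra h u m 0).
  have := b_le _ (lb y); have := l1norm_extra m 0.
  rewrite mulr0 add0r -[k.+1%:R]natr1; lra.
rewrite NE; lra.
Qed.

End tour_length.

(** * Tours of every size *)

(** For [st N] take the first stage whose successor exceeds [N]: by minimality
    [M (st N)] does not exceed [N], except when [st N = 0]. *)
Lemma stage_exists (M : nat -> nat) : (forall N, exists m, (N < M m)%N) ->
  exists st : nat -> nat, st @ \oo --> \oo /\
    \forall N \near \oo, (M (st N) <= N < M (st N).+1)%N.
Proof.
move=> Mub; have ex N : exists m, (N < M m.+1)%N.
  have [[|m] Nm] := Mub (maxn N (M 0)); first by move: Nm; rewrite gtn_max ltnn andbF.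
  by exists m; move: Nm; rewrite gtn_max => /andP[].
pose st N := ex_minn (ex N).
have st_ge k N : (\max_(i < k.+1) M i <= N)%N -> (k <= st N)%N.
  move=> kN; rewrite leqNgt; apply/negP => sk.
  rewrite /st in sk; move: sk; case: ex_minnP => m Nm _ mk.
  move: Nm; rewrite ltnNge => /negP; apply; apply: leq_trans kN.
  by apply: (@leq_bigmax _ (fun i : 'I_k.+1 => M i) (Ordinal (_ : m.+1 < k.+1)%N)).
exists st; split.
  apply/cvgnyPge => k; exists (\max_(i < k.+1) M i)%N => // N /=; exact: st_ge.
exists (\max_(i < 2) M i)%N => // N /= /st_ge; rewrite /st.
case: ex_minnP => m Nm mmin m1; rewrite Nm andbT leqNgt; apply/negP => h.
have [k mE] : exists k, m = k.+1 by exists m.-1; rewrite prednK.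
by have := mmin k; rewrite -mE => /(_ h); rewrite mE ltnn.
Qed.

Section tiles.
Context (R : realType).
Variables (h u : R).
Hypotheses (h_gt0 : 0 < h) (u_ge0 : 0 <= u).

Let l := h + u.
Let l_gt0 : 0 < l. Proof. by rewrite /l ltr_wpDr. Qed.
Let a := 2 * h ^+ 2 + 4 * h * u.
Let a_gt0 : 0 < a.
Proof.
rewrite /a ltr_wpDr//; first by rewrite !mulr_ge0// ltW.
by rewrite mulr_gt0// exprn_gt0.
Qed.

Definition tile (p : int * int) : set (R * R) := cell (site_of h u p) h (h + u).

Definition tiles (s : seq (int * int)) : set (R * R) := \big[setU/set0]_(p <- s) tile p.

Lemma area_tile (c : R * R) : area (cell c h (h + u)) = (2 * h ^+ 2 + 4 * h * u)%:E.
Proof.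
have h0 := h_gt0; have u0 := u_ge0.
rewrite area_cell; last by apply/andP; split; lra.
by congr (_%:E); ring.
Qed.

Lemma measurable_tile (p : int * int) : lebesgue_measurable (tile p).
Proof. exact: borel_lebesgue (measurable_cell _ _ _). Qed.

Lemma measurable_tiles s : lebesgue_measurable (tiles s).
Proof.
elim: s => [|p s IH]; rewrite /tiles ?big_nil ?big_cons; first exact: (@measurable0 _ (plane R)).
by apply: (@measurableU _ (plane R)) => //; exact: measurable_tile.
Qed.

Lemma lebesgue_measurable_disc (rho : R) : lebesgue_measurable (disc rho).
Proof. exact: borel_lebesgue (measurable_disc _). Qed.

Lemma tilesP s x : tiles s x <-> exists2 p, p \in s & tile p x.
Proof.
rewrite /tiles; elim: s => [|q s IH]; first by rewrite big_nil; split => // -[].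
rewrite big_cons; split=> [[qx|/IH[p ps px]]|[p]].
- by exists q; rewrite ?mem_head.
- by exists p => //; rewrite in_cons ps orbT.
- by rewrite in_cons => /predU1P[->|ps px]; [left|right; apply/IH; exists p].
Qed.

Lemma area_tiles_le s : (area (tiles s) <= (a * (size s)%:R)%:E)%E.
Proof.
elim: s => [|p s IH]; first by rewrite /tiles big_nil measure0 mulr0.
rewrite /tiles big_cons; apply: (le_trans (measureU2 _ _ _)).
- exact: measurable_tile.
- exact: measurable_tiles.
have -> : a * (size (p :: s))%:R = a + a * (size s)%:R by rewrite /= -natr1; ring.
rewrite EFinD; apply: leeD; last exact: IH.
by rewrite [X in (X <= _)%E]area_tile.
Qed.

Lemma disc_sub_tiles m : l <= m%:R -> disc (m%:R - l) `<=` tiles (block h u m).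
Proof.
move=> lm x dx; have [p [k [n ->]] cx] := cell_cover h_gt0 u_ge0 x.
apply/tilesP; exists (k, n) => //; apply: disc_mem_block => //.
rewrite -[m%:R](subrK l); apply: disc_l1norm dx; first by rewrite subr_ge0.
by case: cx => _; rewrite l1normB.
Qed.

Lemma block_tiles_sub m : tiles (block h u m) `<=` disc (m%:R + 4 * h + l).
Proof.
move=> x /tilesP[p pb [_ px]]; apply: disc_l1norm px _; last exact: mem_block_disc.
by rewrite addr_ge0// mulr_ge0// ltW.
Qed.

Lemma area_disc_le_block m : l <= m%:R ->
  (area (disc (m%:R - l)) <= (a * (size (block h u m))%:R)%:E)%E.
Proof.
move=> lm; apply: le_trans (area_tiles_le _).
apply: le_measure; rewrite ?inE.
- exact: lebesgue_measurable_disc.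
- exact: measurable_tiles.
- exact: disc_sub_tiles.
Qed.

Lemma block_le_area_disc m :
  ((a * (size (block h u m))%:R)%:E <= area (disc (m%:R + 4 * h + l)))%E.
Proof.
pose s := block h u m; pose A (i : 'I_(size s)) := tile (nth (0, 0) s i).
have mA i : lebesgue_measurable (A i) by exact: measurable_tile.
have A0 i j : i != j -> area (A i `&` A j) = 0%E.
  move=> ij; apply: cell_overlap_null => //; try by eexists; eexists.
  move=> /(site_of_inj h_gt0 u_ge0)/eqP; rewrite nth_uniq// ?uniq_block//.
  by move: ij; rewrite -val_eqE => /negbTE ->.
have mD : measurable (disc (m%:R + 4 * h + l) : set (plane R)) by exact: lebesgue_measurable_disc.
have := @sum_integral_le _ (plane R) R (@area R) _ A (fun=> cst 1%E)
  (fun x => (\1_(disc (m%:R + 4 * h + l)) x)%:E) mA A0.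
have mG : measurable_fun setT (fun x : (plane R) => (\1_(disc (m%:R + 4 * h + l)) x)%:E : \bar R).
  by apply/measurable_EFinP; exact: measurable_indic.
move=> /(_ (fun=> measurable_cst _) ltac:(by []) mG).
have G0 (x : (plane R)) : (0 <= (\1_(disc (m%:R + 4 * h + l)) x : R)%:E)%E by rewrite lee_fin.
have GA i (x : (plane R)) : A i x -> (1 <= (\1_(disc (m%:R + 4 * h + l)) x : R)%:E)%E.
  move=> Ax; rewrite indicE mem_set//; apply: block_tiles_sub; apply/tilesP.
  by exists (nth (0, 0) s i) => //; exact: mem_nth.
move=> /(_ G0 GA); rewrite integral_indic// setIT; apply: le_trans.
rewrite (eq_bigr (fun=> a%:E)); last first.
  move=> i _; transitivity (1 * area (A i))%E; first exact: (@integral_cst _ (plane R) R (@area R) _ (mA i) 1%E).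
  by rewrite mul1e; exact: area_tile.
by rewrite sumEFin sumr_const card_ord mulr_natr.
Qed.

Definition annulus_bound (m : nat) : R :=
  4 * (m%:R + 1 + 4 * h + l) *
  Num.sqrt (2 * (m%:R - l) * (1 + 4 * h + 2 * l) + (1 + 4 * h + 2 * l) ^+ 2).

Lemma area_stage_annulus m : l <= m%:R ->
  (area (disc (m%:R + 1 + 4 * h + l) `\` disc (m%:R - l)) <= (annulus_bound m)%:E)%E.
Proof.
move=> lm; have := @area_annulus_le R (m%:R - l) (1 + 4 * h + 2 * l).
rewrite subr_ge0 => /(_ lm); rewrite /annulus_bound.
have -> : m%:R - l + (1 + 4 * h + 2 * l) = m%:R + 1 + 4 * h + l by ring.
by apply; rewrite !addr_ge0 ?mulr_ge0// ltW.
Qed.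

(** The smaller block covers a disc, the larger block is contained in a disc, and
    the radii of these discs differ by a constant. *)
Lemma block_growth m : l <= m%:R ->
  a * (size (block h u m.+1))%:R <= a * (size (block h u m))%:R + annulus_bound m.
Proof.
move=> lm; rewrite -lee_fin; apply: (le_trans (block_le_area_disc _)); rewrite -natr1.
have sub : disc (m%:R - l) `<=` disc (m%:R + 1 + 4 * h + l).
  by rewrite /disc => x /= /le_trans; apply; have := ltW h_gt0; have := ltW l_gt0; lra.
rewrite -(setDUK sub) EFinD; apply: (le_trans (measureU2 _ _ _)).
- exact: lebesgue_measurable_disc.
- by apply: (@measurableD _ (plane R)); exact: lebesgue_measurable_disc.
by apply: leeD; [exact: area_disc_le_block|exact: area_stage_annulus].
Qed.

Lemma size_block_ge m : l <= m%:R -> 2 * (m%:R - l) ^+ 2 <= a * (size (block h u m))%:R.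
Proof.
move=> lm; rewrite -lee_fin; apply: le_trans (area_disc_le_block lm).
by apply: area_disc_ge; rewrite subr_ge0.
Qed.

Lemma size_block_unbounded N : exists m, (N < size (block h u m))%N.
Proof.
(* a radius for which the lower bound 2 (m - l)^2 exceeds a N *)
pose x : R := a * N%:R + 1 + l; exists (Num.truncn x).+1.
have aN : 0 <= a * N%:R by rewrite mulr_ge0// ltW.
have xm : x < (Num.truncn x).+1%:R by exact: truncnS_gt.
have := @size_block_ge (Num.truncn x).+1; move: xm.
move: (Num.truncn x).+1 => m; rewrite /x => xm; have lm : l <= m%:R by lra.
move=> /(_ lm) H; rewrite -(ltr_nat R) -(ltr_pM2l a_gt0).
have : 1 <= m%:R - l by lra.
nra.
Qed.

Section stage.
Variables (m N : nat).
Hypotheses (lm : l <= m%:R) (mN : (size (block h u m) <= N < size (block h u m.+1))%N).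

Lemma excess_le : a * (N - size (block h u m))%:R <= annulus_bound m.
Proof.
have /andP[h1 h2] := mN; rewrite natrB// mulrBr lerBlDl.
apply: le_trans (block_growth lm).
by apply: ler_wpM2l; [exact: ltW|rewrite ler_nat ltnW].
Qed.

Lemma tour_indices_cat : tour_indices h u m N =
  block h u m ++ [seq extra h u m i | i <- iota 0 (N - size (block h u m))].
Proof.
have /andP[h1 h2] := mN; rewrite /tour_indices take_cat ltnNge h1/=.
by rewrite -map_take take_iota (minn_idPl _)// leq_subr.
Qed.

Lemma disc_sub_tour_tiles : disc (m%:R - l) `<=` tiles (tour_indices h u m N).
Proof.
move=> x /(disc_sub_tiles lm)/tilesP[p pb px]; apply/tilesP; exists p => //.
by rewrite tour_indices_cat mem_cat pb.
Qed.

Lemma area_tour_excess :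
  (area (tiles (tour_indices h u m N) `\` disc (m%:R - l)) <= (2 * annulus_bound m)%:E)%E.
Proof.
set e := [seq extra h u m i | i <- iota 0 (N - size (block h u m))].
apply: (@le_trans _ _ (area ((disc (m%:R + 1 + 4 * h + l) `\` disc (m%:R - l)) `|` tiles e))).
  apply: le_measure; rewrite ?inE.
  - apply: (@measurableD _ (plane R)); [exact: measurable_tiles|exact: lebesgue_measurable_disc].
  - apply: (@measurableU _ (plane R)); last exact: measurable_tiles.
    by apply: (@measurableD _ (plane R)); exact: lebesgue_measurable_disc.
  move=> x [/tilesP[p]]; rewrite tour_indices_cat mem_cat => /orP[pb|pe] px dx.
    left; split => //.
    have : disc (m%:R + 4 * h + l) x by apply: block_tiles_sub; apply/tilesP; exists p.
    rewrite /disc/= => /le_trans; apply; lra.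
  by right; apply/tilesP; exists p.
apply: (le_trans (measureU2 _ _ _)).
- by apply: (@measurableD _ (plane R)); exact: lebesgue_measurable_disc.
- exact: measurable_tiles.
rewrite (_ : 2 * annulus_bound m = annulus_bound m + annulus_bound m); last by ring.
rewrite EFinD; apply: leeD; first exact: area_stage_annulus.
apply: (le_trans (area_tiles_le _)); rewrite lee_fin size_map size_iota.
exact: excess_le.
Qed.

End stage.

End tiles.

Section growth.
Context (R : realType).
Variables (h u : R).
Hypotheses (h_gt0 : 0 < h) (u_ge0 : 0 <= u).
Let l := h + u.
Let v := h + 2 * u.
Let a := 2 * h ^+ 2 + 4 * h * u.
Let v_gt0 : 0 < v. Proof. by rewrite ltr_wpDr ?mulr_ge0. Qed.
Let l_gt0 : 0 < l. Proof. by rewrite /l ltr_wpDr. Qed.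
Let a_gt0 : 0 < a.
Proof.
rewrite /a ltr_wpDr//; first by rewrite !mulr_ge0// ltW.
by rewrite mulr_gt0// exprn_gt0.
Qed.

Let W := 1 + 4 * h + 2 * l.
Definition annulus_const : R := 4 * (2 + 4 * h + l) * Num.sqrt (2 * W + W ^+ 2).

Lemma annulus_const_ge0 : 0 <= annulus_const.
Proof. by rewrite /annulus_const !mulr_ge0 ?sqrtr_ge0// !addr_ge0 ?mulr_ge0// ltW. Qed.

Lemma annulus_bound_le m : (0 < m)%N -> l <= m%:R ->
  annulus_bound h u m <= annulus_const * (m%:R * Num.sqrt m%:R).
Proof.
move=> m0 lm; have h0 := h_gt0; have l0 := l_gt0.
have m1 : 1 <= m%:R :> R by rewrite ler1n.
have W0 : 0 <= W by rewrite /W; lra.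
rewrite /annulus_bound /annulus_const -/l -/W.
have s : Num.sqrt (2 * (m%:R - l) * W + W ^+ 2) <= Num.sqrt (2 * W + W ^+ 2) * Num.sqrt m%:R.
  rewrite -sqrtrM ?addr_ge0 ?mulr_ge0 ?sqr_ge0//; apply: ler_wsqrtr.
  have : 0 <= W ^+ 2 * (m%:R - 1) by rewrite mulr_ge0 ?sqr_ge0// subr_ge0.
  have : 0 <= l * W by rewrite mulr_ge0// ltW.
  lra.
have c : 4 * (m%:R + 1 + 4 * h + l) <= 4 * (2 + 4 * h + l) * m%:R.
  have : 0 <= (1 + 4 * h + l) * (m%:R - 1) by rewrite mulr_ge0// ?subr_ge0//; lra.
  lra.
rewrite (_ : _ * (m%:R * _) = 4 * (2 + 4 * h + l) * m%:R * (Num.sqrt (2 * W + W ^+ 2) * Num.sqrt m%:R)).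
  by apply: ler_pM => //; rewrite mulr_ge0//; lra.
by ring.
Qed.

Definition slack_const : R := 2 * h * (annulus_const / a) +
  (Num.sqrt (2 * v) + 3 * h + v) * (2 / v + 1) + (8 + 27 * h + 2 * v).

Lemma slack_const_ge0 : 0 <= slack_const.
Proof.
have h0 := ltW h_gt0; have v0 := ltW v_gt0; have a0 := ltW a_gt0.
have C0 := annulus_const_ge0.
have Ca : 0 <= annulus_const / a by rewrite divr_ge0.
have v2 : 0 <= 2 / v by rewrite divr_ge0.
have s0 : 0 <= Num.sqrt (2 * v) by exact: sqrtr_ge0.
have p1 : 0 <= 2 * h * (annulus_const / a) by rewrite mulr_ge0// mulr_ge0.
have p2 : 0 <= (Num.sqrt (2 * v) + 3 * h + v) * (2 / v + 1) by apply: mulr_ge0; lra.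
rewrite /slack_const; lra.
Qed.

Lemma tour_slack_le m N : (0 < m)%N -> l <= m%:R ->
  (size (block h u m) <= N < size (block h u m.+1))%N ->
  2 * h * (N - size (block h u m))%:R +
  jump h u m * (rows h u m).*2.+1%:R + (8 * m%:R + 27 * h + 2 * v) <=
  slack_const * (m%:R * Num.sqrt m%:R).
Proof.
move=> m0 lm mN; have h0 := h_gt0; have v0 := v_gt0.
have m1 : 1 <= m%:R :> R by rewrite ler1n.
have s1 : 1 <= Num.sqrt m%:R :> R by rewrite -[X in X <= _]sqrtr1 ler_wsqrtr.
have ms : m%:R <= m%:R * Num.sqrt m%:R :> R by rewrite ler_peMr.
rewrite /slack_const [leRHS]mulrDl [X in _ <= X + _]mulrDl; apply: lerD; first apply: lerD.
- rewrite -[leRHS]mulrA; apply: ler_wpM2l; first by rewrite mulr_ge0// ltW.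
  rewrite mulrAC ler_pdivlMr// mulrC.
  by apply: le_trans (excess_le h_gt0 u_ge0 lm mN) _; exact: annulus_bound_le.
- rewrite [m%:R * _]mulrC mulrACA; apply: ler_pM.
  + by rewrite /jump !addr_ge0 ?sqrtr_ge0 ?mulr_ge0// ltW.
  + by [].
  + rewrite /jump -/v sqrtrM ?mulr_ge0 ?(ltW v0)//.
    have : 3 * h <= 3 * h * Num.sqrt m%:R by rewrite ler_peMr ?mulr_ge0 ?(ltW h0).
    have : v <= v * Num.sqrt m%:R by rewrite ler_peMr ?(ltW v0).
    lra.
  + have := rows_le h_gt0 u_ge0 m; rewrite -/v -ler_pdivlMr// => rm.
    have -> : (rows h u m).*2.+1%:R = 2 * (rows h u m)%:R + 1 :> R.
      by rewrite -natr1 -mul2n natrM.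
    lra.
- have h27 : 27 * h <= 27 * h * (m%:R * Num.sqrt m%:R).
    by rewrite ler_peMr ?mulr_ge0 ?(ltW h0)//; lra.
  have v2 : 2 * v <= 2 * v * (m%:R * Num.sqrt m%:R).
    by rewrite ler_peMr ?mulr_ge0 ?(ltW v0)//; lra.
  lra.
Qed.

Lemma half_sqr_le m : 2 * l <= m%:R -> m%:R ^+ 2 / 2 <= 2 * (m%:R - l) ^+ 2.
Proof.
move=> lm; have l0 := l_gt0.
have : (m%:R / 2) ^+ 2 <= (m%:R - l) ^+ 2 by rewrite lerXn2r ?nnegrE//; lra.
lra.
Qed.

(** The form of all error terms: a quantity of order [m sqrt m] divided by one of
    order [m^2]. *)
Lemma over_sqr_le m (c d b : R) : (0 < m)%N -> 0 <= c -> m%:R ^+ 2 / 2 <= b ->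
  d <= c * (m%:R * Num.sqrt m%:R) -> d / b <= 2 * c / Num.sqrt m%:R.
Proof.
move=> m0 c0 mb dc; have m1 : 0 < m%:R :> R by rewrite ltr0n.
have s0 : 0 < Num.sqrt m%:R :> R by rewrite sqrtr_gt0.
have ss : Num.sqrt m%:R ^+ 2 = m%:R :> R by rewrite sqr_sqrtr// ltW.
have b0 : 0 < b by apply: lt_le_trans mb; rewrite divr_gt0// exprn_gt0.
rewrite ler_pdivrMr//; apply: (le_trans dc).
apply: (@le_trans _ _ (2 * c / Num.sqrt m%:R * (m%:R ^+ 2 / 2))); last first.
  by apply: ler_wpM2l => //; rewrite divr_ge0 ?mulr_ge0// ltW.
rewrite le_eqVlt; apply/orP; left; apply/eqP.
move: s0 ss; move: (Num.sqrt m%:R) => s s0 <-; field; by rewrite gt_eqF.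
Qed.

End growth.

Lemma cvg_inv_sqrt (R : realType) (c : R) (st : nat -> nat) : st @ \oo --> \oo ->
  (fun N => c / Num.sqrt (st N)%:R) @ \oo --> (0 : R).
Proof.
move=> st_oo; rewrite -(mulr0 c); apply: cvgM; first exact: cvg_cst.
have H : (fun m => (Num.sqrt m%:R)^-1 : R) @ \oo --> (0 : R).
  rewrite -(@cvg_shiftS _).
  rewrite (_ : (fun m : nat => (Num.sqrt m.+1%:R)^-1) = Num.sqrt \o @harmonic R); last first.
    by apply/funext => m; rewrite -sqrtrV.
  by have := cvg_comp _ _ (@cvg_harmonic R) (@sqrt_continuous R 0); rewrite sqrtr0.
exact: (cvg_comp _ _ st_oo H).
Qed.

(** * The cost of the hexagonal design *)

Section hexagonal_design.
Context (R : realType).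
Variables (h u : R).
Hypotheses (h_gt0 : 0 < h) (u_ge0 : 0 <= u).
Let l := h + u.
Let a := 2 * h ^+ 2 + 4 * h * u.
Let l_gt0 : 0 < l. Proof. by rewrite /l ltr_wpDr. Qed.
Let a_gt0 : 0 < a.
Proof.
rewrite /a ltr_wpDr//; first by rewrite !mulr_ge0// ltW.
by rewrite mulr_gt0// exprn_gt0.
Qed.

Definition hexagonal_design (st : nat -> nat) : design_data R := {|
  facilities := lattice h u;
  region := fun p => cell p h (h + u);
  tour := fun N i => site_of h u (nth (0, 0) (tour_indices h u (st N) N) i) |}.

(** Blocks are finite sets of sites of unbounded size. *)
Lemma lattice_infinite : infinite_set (lattice h u).
Proof.
move=> /finite_seqP[s sE].
have [m] := size_block_unbounded h_gt0 u_ge0 (size s).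
rewrite ltnNge => /negP; apply.
rewrite -(size_map (site_of h u)); apply: uniq_leq_size.
  by rewrite (map_inj_uniq (site_of_inj h_gt0 u_ge0)) uniq_block.
move=> _ /mapP[[k n] _ ->].
have : lattice h u (site_of h u (k, n)) by exists k, n.
by rewrite sE.
Qed.

Lemma lattice_locally_finite rho : finite_set (lattice h u `&` disc rho).
Proof.
pose m := (Num.truncn rho).+1.
apply: (@sub_finite_set _ _ [set` map (site_of h u) (block h u m)]); last first.
  exact: finite_seq.
move=> _ [[k [n ->]] kn].
have /(map_f (site_of h u)) : (k, n) \in block h u m; last by [].
apply: (disc_mem_block h_gt0 u_ge0); move: kn; rewrite /disc/= => /le_trans; apply.
by rewrite ltW// truncnS_gt.
Qed.

Variable st : nat -> nat.
Hypothesis st_oo : st @ \oo --> \oo.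
Hypothesis stP : \forall N \near \oo,
  (size (block h u (st N)) <= N < size (block h u (st N).+1))%N.

Let near_st (x : R) : \forall N \near \oo, [/\ (0 < st N)%N, x <= (st N)%:R &
  (size (block h u (st N)) <= N < size (block h u (st N).+1))%N].
Proof.
have /cvgnyPge/(_ (Num.truncn x).+1) H := st_oo.
near=> N; have k : ((Num.truncn x).+1 <= st N)%N by near: N.
split; [exact: leq_trans k| |by near: N].
by apply: (le_trans (ltW (truncnS_gt x))); rewrite ler_nat.
Unshelve. all: by end_near. Qed.

Lemma tour_regionsE N :
  tour_regions (hexagonal_design st) N = tiles h u (tour_indices h u (st N) N).
Proof.
apply/seteqP; split=> [x [i _ xi]|x /tilesP[p /(nthP (0, 0))[i]]].
  by apply/tilesP; exists (nth (0, 0) (tour_indices h u (st N) N) i) => //;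
     rewrite mem_nth// size_tour_indices.
rewrite size_tour_indices => iN pE px; exists (Ordinal iN) => //=.
by rewrite /= pE.
Qed.

Lemma tour_exhausts_hexagonal : exists rho : nat -> R,
    [/\ rho @ \oo --> +oo,
        \forall N \near \oo, area (disc (rho N) `\` tour_regions (hexagonal_design st) N) = 0%E
      & (area (tour_regions (hexagonal_design st) N `\` disc (rho N)) /
         area (tour_regions (hexagonal_design st) N))%E @[N --> \oo] --> 0%E].
Proof.
exists (fun N => (st N)%:R - l); split.
- apply/cvgryPge => A; have := near_st (A + l); apply: filterS => N [_ H _]; lra.
- have := near_st l; apply: filterS => N [_ lm mN].
  rewrite tour_regionsE (_ : _ `\` _ = set0) ?measure0// -subset0.
  by move=> x [/(disc_sub_tour_tiles h_gt0 u_ge0 lm mN)].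
pose C := 2 * annulus_const h u.
apply: (@squeeze_cvge _ _ _ _ (cst 0%E) _ (fun N => (2 * C / Num.sqrt (st N)%:R)%:E)).
- have := near_st (2 * l); apply: filterS => N [m0 lm mN].
  have lm' : l <= (st N)%:R by have := l_gt0; lra.
  rewrite tour_regionsE.
  set T := tiles _ _ _; set D := disc _.
  have mT : measurable (T : set (plane R)) by exact: measurable_tiles.
  have mD : measurable (D : set (plane R)) by exact: lebesgue_measurable_disc.
  have DT : (area D <= area T)%E.
    by apply: le_measure; rewrite ?inE//; exact: (disc_sub_tour_tiles h_gt0 u_ge0 lm' mN).
  have b1 : ((2 * ((st N)%:R - l) ^+ 2)%:E <= area T)%E.
    by apply: le_trans DT; apply: area_disc_ge; rewrite subr_ge0.
  have T1 : (area T <= (a * (size (tour_indices h u (st N) N))%:R)%:E)%E by exact: area_tiles_le.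
  have E1 : (area (T `\` D) <= (2 * annulus_bound h u (st N))%:E)%E by exact: area_tour_excess.
  move: T1 b1 E1; have := measure_ge0 (@area R) (T `\` D).
  case: (area T) => [q| |]//=.
  case: (area (T `\` D)) => [p| |]//=.
  rewrite !lee_fin => p0 _ b1 E1.
  have b2 : (st N)%:R ^+ 2 / 2 <= q by apply: le_trans b1; exact: half_sqr_le.
  have q0 : 0 < q by apply: lt_le_trans b2; rewrite divr_gt0// exprn_gt0// ltr0n.
  rewrite inver gt_eqF// -EFinM !lee_fin divr_ge0 ?(ltW q0)//=.
  apply: over_sqr_le => //; first by rewrite mulr_ge0 ?annulus_const_ge0.
  apply: le_trans E1 _; rewrite /C -mulrA ler_pM2l//; exact: annulus_bound_le.
- exact: cvg_cst.
- by apply: cvg_EFin; [exact: nearW|exact: cvg_inv_sqrt].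
Qed.

Lemma hexagonal_is_design : is_design (@l1norm R) (hexagonal_design st).
Proof.
split => /=.
- exact: lattice_infinite.
- exact: lattice_locally_finite.
- by move=> p _; exact: borel_lebesgue (measurable_cell _ _ _).
- by move=> p _; rewrite area_tile// lte_fin ltry.
- apply/seteqP; split => // x _.
  by have [p pl px] := cell_cover h_gt0 u_ge0 x; exists p.
- by move=> p q pl ql pq; exact: cell_overlap_null.
- by move=> p q x pl ql xp; exact: cell_nearest ql xp.
- by move=> N i; eexists; eexists.
- move=> N i j /(site_of_inj h_gt0 u_ge0)/eqP.
  by rewrite nth_uniq ?size_tour_indices ?uniq_tour_indices// => /eqP/val_inj.
- exact: tour_exhausts_hexagonal.
Qed.

Lemma sum_travel_hexagonal N : (0 < st N)%N -> l <= (st N)%:R ->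
  (size (block h u (st N)) <= N < size (block h u (st N).+1))%N ->
  \sum_(i < N) travel (@l1norm R) (hexagonal_design st) i <=
  2 * h * N%:R + slack_const h u * ((st N)%:R * Num.sqrt (st N)%:R).
Proof.
move=> m0 lm mN; rewrite sum_travel; last exact: l1normB.
have /andP[MN _] := mN.
case: N m0 lm mN MN => [|n] m0 lm mN MN.
  rewrite big_ord0 mulr0 add0r.
  apply: le_trans (tour_slack_le h_gt0 u_ge0 m0 lm mN).
  rewrite !addr_ge0 ?mulr_ge0 ?sqrtr_ge0 ?(ltW h_gt0)//.
set s := tour_indices h u (st n.+1) n.+1.
have -> : \sum_(i < n.+1) l1norm (tour (hexagonal_design st) i - tour (hexagonal_design st) (ord_pred i)) =
    path_length (site_dist h u) (last (0, 0) s) s.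
  rewrite -(path_length_cyclic _ _ (size_tour_indices h u (st n.+1) n.+1)).
  by apply: eq_bigr => i _; rewrite l1normB.
apply: le_trans (tour_path_le h_gt0 u_ge0 (0, 0) MN) _.
have := tour_slack_le h_gt0 u_ge0 m0 lm mN; lra.
Qed.

Lemma cost_hexagonal_le f kappa r : 0 < f -> 0 < kappa -> 0 <= r ->
  (cost (@l1norm R) f kappa r (hexagonal_design st) <=
   (f * (1 + kappa * (2 * (l ^+ 2 * h - h ^+ 3 / 3))) / a + kappa * r * f * (2 * h))%:E)%E.
Proof.
move=> f0 k0 r0; set I := 2 * _.
pose z := f * (1 + kappa * I) / a + kappa * r * f * (2 * h).
rewrite -[X in (_ <= X%:E)%E]/z.
have krf : 0 <= kappa * r * f by rewrite !mulr_ge0// ltW.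
have sl0 := slack_const_ge0 h_gt0 u_ge0.
pose w N : \bar R := (z + kappa * r * f * (a * (2 * slack_const h u / Num.sqrt (st N)%:R)))%:E.
have wz : w @ \oo --> z%:E.
  apply: cvg_EFin; first exact: nearW.
  rewrite -[X in _ --> X]addr0; apply: cvgD; first exact: cvg_cst.
  rewrite -(mulr0 (kappa * r * f)); apply: cvgM; first exact: cvg_cst.
  by rewrite -(mulr0 a); apply: cvgM; [exact: cvg_cst|exact: cvg_inv_sqrt].
rewrite -(cvg_limn_einf_sup wz).1; apply: le_limn_einf.
have := near_st (2 * l); apply: filterS => N [m0 lm mN].
have lm' : l <= (st N)%:R by have := l_gt0; lra.
have sb := size_block_ge h_gt0 u_ge0 lm'; have /andP[MN _] := mN.
have aN : (st N)%:R ^+ 2 / 2 <= a * N%:R.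
  apply: (le_trans (half_sqr_le h_gt0 u_ge0 lm)); apply: (le_trans sb).
  by apply: ler_wpM2l; [exact: ltW|rewrite ler_nat].
have aN0 : 0 < a * N%:R by apply: lt_le_trans aN; rewrite divr_gt0// exprn_gt0// ltr0n.
have N0 : 0 < N%:R :> R by rewrite -(pmulr_rgt0 _ a_gt0).
rewrite /partial_cost /w /=.
under [X in (f%:E / X * _)%E]eq_bigr do rewrite area_tile//.
rewrite [X in (_ * X + _)%E](_ : _ = (N%:R * (1 + kappa * I))%:E); last first.
  rewrite (eq_bigr (fun=> (1 + kappa * I)%:E)); last first.
    move=> i _; rewrite integral_norm_cell//.
    by rewrite (ltW h_gt0)/= lerDl.
  by rewrite sumEFin sumr_const card_ord -[in LHS](mulr_natl (1 + kappa * I)).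
rewrite sumEFin sumr_const card_ord -/a -(mulr_natr a) inver gt_eqF// -!EFinM -EFinD lee_fin.
have -> : f / (a * N%:R) * (N%:R * (1 + kappa * I)) = f * (1 + kappa * I) / a.
  by field; rewrite !gt_eqF.
rewrite /z -addrA lerD2l -mulrDr mulrAC -mulrA; apply: ler_wpM2l => //.
rewrite ler_pdivrMr//; apply: (le_trans (sum_travel_hexagonal m0 lm' mN)).
have := over_sqr_le m0 sl0 aN (lexx _); rewrite ler_pdivrMr//; lra.
Qed.

End hexagonal_design.

(** * The optimal hexagon *)

Section optimal_hexagon.
Context (R : realType).
Variable r : R.
Hypothesis r_ge0 : 0 <= r.

Let c := cos (alpha_star r).
Let s := sin (alpha_star r).

Lemma alpha_star_itv : 0 <= alpha_star r < pi / 2.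
Proof.
rewrite atan_ltpi2 andbT -atan0; apply: le_atan.
by rewrite addr_ge0 ?sqrtr_ge0 ?mulr_ge0.
Qed.

Lemma cos_alpha_gt0 : 0 < c.
Proof.
have /andP[a0 a1] := alpha_star_itv; apply: cos_gt0_pihalf.
by rewrite a1 (lt_le_trans _ a0)// oppr_lt0 divr_gt0// pi_gt0.
Qed.

Lemma sin_alpha_ge0 : 0 <= s.
Proof.
have /andP[a0 a1] := alpha_star_itv; apply: sin_ge0_pi; rewrite a0/=.
have := pi_gt0 R; lra.
Qed.

(** The tangent of the angle is the nonnegative root of [t^2 - 4 r t - 2 r]. *)
Lemma sin_alpha_sqr : s ^+ 2 = r * (2 * c * (c + 2 * s)).
Proof.
pose t := 2 * r + Num.sqrt (2 * r + 4 * r ^+ 2).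
have c0 := cos_alpha_gt0.
have tE : s = t * c.
  by rewrite -[t]atanK /tan -/(alpha_star r) divfK// gt_eqF.
have t2 : (t - 2 * r) ^+ 2 = 2 * r + 4 * r ^+ 2.
  rewrite /t addrC addKr sqr_sqrtr// addr_ge0 ?mulr_ge0 ?sqr_ge0//.
apply/eqP; rewrite tE -subr_eq0; apply/eqP.
transitivity (c ^+ 2 * ((t - 2 * r) ^+ 2 - (2 * r + 4 * r ^+ 2))); first by ring.
by rewrite t2 subrr mulr0.
Qed.

(** The hexagon of parameter [alpha_star r] has area 1 when its scale is the
    inverse of this number. *)
Definition unit_scale : R := Num.sqrt (2 * c * (c + 2 * s)).

Let q_gt0 : 0 < 2 * c * (c + 2 * s).
Proof.
by rewrite !mulr_gt0 ?cos_alpha_gt0// ltr_wpDr ?mulr_ge0 ?sin_alpha_ge0 ?cos_alpha_gt0.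
Qed.

Lemma unit_scale_gt0 : 0 < unit_scale. Proof. by rewrite sqrtr_gt0. Qed.

Let scale2 : unit_scale ^+ 2 = 2 * c * (c + 2 * s).
Proof. by rewrite sqr_sqrtr// ltW. Qed.

Definition unit_h : R := c / unit_scale.
Definition unit_u : R := s / unit_scale.

Lemma unit_h_gt0 : 0 < unit_h.
Proof. by rewrite divr_gt0 ?cos_alpha_gt0 ?unit_scale_gt0. Qed.

Lemma unit_u_ge0 : 0 <= unit_u.
Proof. by rewrite divr_ge0 ?sin_alpha_ge0// ltW// unit_scale_gt0. Qed.

Lemma unit_u_sqr : unit_u ^+ 2 = r.
Proof. by rewrite expr_div_n scale2 sin_alpha_sqr mulfK// gt_eqF. Qed.

Lemma unit_hexagon_area : 2 * unit_h ^+ 2 + 4 * unit_h * unit_u = 1.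
Proof.
rewrite /unit_h /unit_u.
transitivity ((2 * c * (c + 2 * s)) / unit_scale ^+ 2).
  by field; rewrite gt_eqF ?unit_scale_gt0.
by rewrite scale2 divff// gt_eqF.
Qed.

(** At unit area [G] is [4/3 h (h^2 + 3 h u + 3 u^2)], and the denominator of
    [gbar] is [2 (c^2 + 3 c s + 3 s^2)] with [c] and [s] the cosine and sine of
    the angle. *)
Lemma gbarE : (gbar r)^-1 =
  unit_h + unit_u - 2 / 3 * unit_h ^+ 3 - 2 * unit_h ^+ 2 * unit_u.
Proof.
have c0 := cos_alpha_gt0; have s0 := sin_alpha_ge0; have S0 := unit_scale_gt0.
have d0 : 0 < 2 * s + c by rewrite ltr_wpDl// mulr_ge0.
have trig : 3 * sin (2 * alpha_star r) - 2 * cos (2 * alpha_star r) + 4 =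
    2 * (c ^+ 2 + 3 * c * s + 3 * s ^+ 2).
  rewrite (mulr_natl (alpha_star r) 2) sin_mulr2n cos_mulr2n -/c -/s.
  have : c ^+ 2 + s ^+ 2 = 1 by exact: cos2Dsin2.
  lra.
have num : (2 * c) `^ (1 / 2) * (2 * s + c) `^ (3 / 2) = unit_scale * (2 * s + c).
  have -> : 3 / 2 = 1 + 2^-1 :> R by field.
  rewrite powRD; last by rewrite (gt_eqF d0) implybT.
  rewrite powRr1 ?(ltW d0)// div1r !powR12_sqrt ?(ltW d0)//; last by rewrite mulr_ge0// ltW.
  have -> : unit_scale = Num.sqrt (2 * c) * Num.sqrt (2 * s + c).
    by rewrite -sqrtrM ?mulr_ge0 ?(ltW c0)// [2 * s + c]addrC.
  by ring.
rewrite /gbar -/c -/s -[3 * _ * _]mulrA num trig.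
set G := RHS.
have GE : G = 4 / 3 * unit_h * (unit_h ^+ 2 + 3 * unit_h * unit_u + 3 * unit_u ^+ 2).
  transitivity ((unit_h + unit_u) * (2 * unit_h ^+ 2 + 4 * unit_h * unit_u) -
      2 / 3 * unit_h ^+ 3 - 2 * unit_h ^+ 2 * unit_u).
    by rewrite unit_hexagon_area mulr1.
  by field.
have k0 : 0 < c ^+ 2 + 3 * c * s + 3 * s ^+ 2.
  by rewrite -addrA ltr_wpDr ?exprn_gt0// addr_ge0 ?mulr_ge0 ?sqr_ge0// ltW.
rewrite GE /unit_h /unit_u.
transitivity (2 / 3 * (c ^+ 2 + 3 * c * s + 3 * s ^+ 2) / (unit_scale * (2 * s + c))).
  by field; rewrite !gt_eqF.
transitivity (2 / 3 * (c ^+ 2 + 3 * c * s + 3 * s ^+ 2) * (2 * c * (c + 2 * s)) /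
   (unit_scale ^+ 2 * unit_scale * (2 * s + c))).
  by rewrite -scale2; field; rewrite !gt_eqF.
by field; rewrite !gt_eqF.
Qed.

End optimal_hexagon.

Lemma cube_rootK (R : realType) (x : R) : 0 <= x -> (x `^ (1 / 3)) ^+ 3 = x.
Proof.
by move=> x0; rewrite -powR_mulrn ?powR_ge0// -powRrM div1r mulVf// powRr1.
Qed.

Lemma translate_hexagon (R : realType) (p : R * R) (s alpha : R) :
  [set p + y | y in hexagon s alpha] = cell p (s * cos alpha) (s * cos alpha + s * sin alpha).
Proof.
apply/seteqP; split=> [_ [y [/= y1 y2] <-]|x [x1 x2]].
  by split; rewrite /l1norm/= [_ + _ - _]addrC ?[p.2 + _ - _]addrC !addKr// -mulrDr.
exists (x - p); last by rewrite addrC subrK.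
by split => //=; rewrite mulrDr.
Qed.

Theorem proposition5 (R : realType) (f kappa r : R)
    (f_gt0 : 0 < f) (kappa_gt0 : 0 < kappa) (r_ge0 : 0 <= r) :
  optimal_value (@l1norm R) f kappa r =
    (3 * (kappa ^+ 2 * f ^+ 3 / (4 * gbar r ^+ 2)) `^ (1 / 3))%:E /\
  exists (D : design_data R) (H : set (R * R)),
    [/\ is_design (@l1norm R) D,
        cost (@l1norm R) f kappa r D = optimal_value (@l1norm R) f kappa r,
        elongated_hexagon (alpha_star r) H
      & forall p, facilities D p -> region D p = [set p + y | y in H]].
Proof.
have h0 := unit_h_gt0 r_ge0; have u0 := unit_u_ge0 r_ge0.
have ur := unit_u_sqr r_ge0; have A1 := unit_hexagon_area r_ge0.
have GE := gbarE r_ge0.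
set h1 := unit_h r in h0 A1 GE; set u1 := unit_u r in u0 ur A1 GE.
set G := RHS in GE.
have G0 : 0 < G.
  rewrite /G; have : 0 < (h1 + u1) * (2 * h1 ^+ 2 + 4 * h1 * u1) - 2 / 3 * h1 ^+ 3 - 2 * h1 ^+ 2 * u1.
    have : 0 < h1 ^+ 3 by rewrite exprn_gt0.
    have : 0 <= h1 * u1 ^+ 2 by rewrite mulr_ge0 ?sqr_ge0 ?(ltW h0).
    have : 0 <= h1 ^+ 2 * u1 by rewrite mulr_ge0 ?sqr_ge0.
    lra.
  by rewrite A1 mulr1.
pose w := (kappa * G / 2) `^ (1 / 3).
have w3 : w ^+ 3 = kappa * G / 2.
  by rewrite cube_rootK// divr_ge0// mulr_ge0 ?(ltW kappa_gt0) ?(ltW G0).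
have w0 : 0 < w by rewrite powR_gt0// divr_gt0// mulr_gt0.
have w_cube : 2 * w ^+ 3 = kappa * G by rewrite w3 mulrC divfK.
have zE : 3 * (kappa ^+ 2 * f ^+ 3 / (4 * gbar r ^+ 2)) `^ (1 / 3) = f * (3 * w ^+ 2).
  have -> : kappa ^+ 2 * f ^+ 3 / (4 * gbar r ^+ 2) = (f * w ^+ 2) ^+ 3.
    have -> : (f * w ^+ 2) ^+ 3 = f ^+ 3 * (w ^+ 3) ^+ 2 by ring.
    have g0 : 0 < gbar r by rewrite -invr_gt0 GE.
    by rewrite w3 -GE; field; rewrite gt_eqF.
  have fw : 0 <= f * w ^+ 2 by rewrite mulr_ge0 ?sqr_ge0// ltW.
  by rewrite -powR_mulrn// -powRrM div1r mulfV// powRr1//; ring.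
have lower D : is_design (@l1norm R) D ->
    ((f * (3 * w ^+ 2))%:E <= cost (@l1norm R) f kappa r D)%E.
  by move=> dD; exact (cost_ge f_gt0 kappa_gt0 h0 u0 ur w0 w_cube dD).
pose h := h1 / w; pose u := u1 / w.
have hh : 0 < h by rewrite divr_gt0.
have uu : 0 <= u by rewrite divr_ge0// ltW.
have [st [st_oo stP]] := stage_exists (size_block_unbounded hh uu).
pose D := hexagonal_design h u st.
have dD : is_design (@l1norm R) D := hexagonal_is_design hh uu st_oo stP.
have upper : (cost (@l1norm R) f kappa r D <= (f * (3 * w ^+ 2))%:E)%E.
  apply: le_trans (cost_hexagonal_le hh uu st_oo stP f_gt0 kappa_gt0 r_ge0) _.
  have aE : 2 * h ^+ 2 + 4 * h * u = (w ^+ 2)^-1.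
    transitivity ((2 * h1 ^+ 2 + 4 * h1 * u1) / w ^+ 2); last by rewrite A1 mul1r.
    by rewrite /h /u; field; rewrite gt_eqF.
  rewrite aE invrK lee_fin le_eqVlt; apply/orP; left; apply/eqP.
  have GE2 : G = (h1 + u1) * (2 * h1 ^+ 2 + 4 * h1 * u1) - 2 / 3 * h1 ^+ 3 - 2 * h1 ^+ 2 * u1.
    by rewrite A1 mulr1.
  transitivity (f * w ^+ 2 + f * (kappa * G) / w).
    by rewrite GE2 -ur /h /u; field; rewrite gt_eqF.
  by rewrite -w_cube; field; rewrite gt_eqF.
have costE : cost (@l1norm R) f kappa r D = (f * (3 * w ^+ 2))%:E.
  by apply/eqP; rewrite eq_le upper lower.
have optE : optimal_value (@l1norm R) f kappa r = (f * (3 * w ^+ 2))%:E.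
  apply/eqP; rewrite eq_le; apply/andP; split.
    by rewrite -costE; apply: ereal_inf_lbound; exists D.
  by apply: le_ereal_inf_tmp => _ [D' dD' <-]; exact: lower.
split; first by rewrite optE zE.
(* the area 1 / w^2 attains the minimum over y *)
pose s := (unit_scale r * w)^-1.
have s0 : 0 < s by rewrite invr_gt0 mulr_gt0 ?unit_scale_gt0.
exists D, (hexagon s (alpha_star r)); split => //.
- by rewrite costE optE.
- by split; [exact: alpha_star_itv|exists s => //; left].
- move=> p _; rewrite translate_hexagon /=.
  have -> : s * cos (alpha_star r) = h by rewrite /s invfM /h /h1 /unit_h; ring.
  by have -> : s * sin (alpha_star r) = u by rewrite /s invfM /u /u1 /unit_u; ring.
Qed.
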